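(* Let $X=(x_1,\dots,x_n)\in\mathbb{R}^{d_x\times n}$ and $Y=(y_1,\dots,y_n)\in\mathbb{R}^{d_y\times n}$. Let $L\ge 2$ and $m\ge\max\{d_x,d_y\}$ be integers. Consider the $L$-layer linear network $f(x;W_1,\dots,W_L)=\alpha W_LW_{L-1}\cdots W_1x$ with $W_1\in\mathbb{R}^{m\times d_x}$, $W_i\in\mathbb{R}^{m\times m}$ for $2\le i\le L-1$, $W_L\in\mathbb{R}^{d_y\times m}$, and $\alpha=\frac{1}{\sqrt{m^{L-1}d_y}}$, trained on the loss $$\ell(W_1,\dots,W_L)=\tfrac12\|\alpha W_L\cdots W_1X-Y\|_F^2$$ by gradient descent $W_i(t+1)=W_i(t)-\eta\,\frac{\partial\ell}{\partial W_i}(W_1(t),\dots,W_L(t))$, $i\in[L]$, $t=0,1,2,\dots$, where the initial matrices $W_1(0),\dots,W_L(0)$ are independent and each $W_i(0)$ is drawn uniformly from the set of matrices satisfying $W_1^\top(0)W_1(0)=mI_{d_x}$; $W_i^\top(0)W_i(0)=W_i(0)W_i^\top(0)=mI_m$ for $2\le i\le L-1$; $W_L(0)W_L^\top(0)=mI_{d_y}$. Let $W^*\in\arg\min_{W\in\mathbb{R}^{d_y\times d_x}}\|WX-Y\|_F$, $\ell^*=\frac12\|W^*X-Y\|_F^2$, $r=\mathrm{rank}(X)$, $\kappa=\lambda_{\max}(X^\top X)/\lambda_r(X^\top X)$ and $\tilde r=\|X\|_F^2/\|X\|^2$. There exist universal constants $C>0$ and $C'>0$ such that the following holds. Let $\delta\in(0,1)$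 and suppose $$m\ge C\,\tilde r\,\kappa^2\big(d_y(1+\|W^*\|^2)+\log(r/\delta)\big)\quad\text{and}\quad m\ge d_x,$$ and let the learning rate satisfy $0<\eta\le\frac{d_y}{2L\|X\|^2}$. Then with probability at least $1-\delta$ over the random initialization, $$\ell(0)-\ell^*\le C'\Big(1+\frac{\log(r/\delta)}{d_y}+\|W^*\|^2\Big)\|X\|_F^2,$$ and for all $t=0,1,2,\dots$, $$\ell(t)-\ell^*\le\Big(1-\tfrac12\eta L\lambda_r(X^\top X)/d_y\Big)^t(\ell(0)-\ell^* ),$$ where $\ell(t)=\ell(W_1(t),\dots,W_L(t))$.
   Context: $\|\cdot\|$ denotes the Euclidean norm of a vector and the spectral norm of a matrix, $\|\cdot\|_F$ the Frobenius norm; $\lambda_{\max}$ and $\lambda_i$ denote the largest and $i$-th largest eigenvalue of a symmetric matrix; $[L]=\{1,\dots,L\}$. *)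

(* Defs.v *)
From HB Require Import structures.
From mathcomp Require Import all_boot all_order all_algebra.
From mathcomp Require Import all_classical all_reals all_analysis.

Set Implicit Arguments.
Unset Strict Implicit.
Unset Printing Implicit Defensive.

Import Order.TTheory GRing.Theory Num.Theory.
Import numFieldNormedType.Exports.
Local Open Scope classical_set_scope.
Local Open Scope ring_scope.

Section Defs.
Variable R : realType.

Definition frob2 p q (A : 'M[R]_(p, q)) : R := \sum_i \sum_j (A i j) ^+ 2.

Definition frobn p q (A : 'M[R]_(p, q)) : R := Num.sqrt (frob2 A).

Definition specn p q (A : 'M[R]_(p, q)) : R :=
  sup [set frobn (A *m v) | v in [set v : 'cV[R]_q | frobn v <= 1]].

(* The eigenvalues of S, counted with multiplicity and listed in
   nonincreasing order: the (unique) nonincreasing sequence s with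
   char_poly S = prod_(x <- s) (X - x).  Such a sequence exists for every
   real symmetric matrix; [::] is a junk value otherwise. *)
Definition eigseq n (S : 'M[R]_n) : seq R :=
  match pselect (exists s : seq R,
      sorted (fun x y : R => y <= x) s /\
      char_poly S = \prod_(x <- s) ('X - x%:P)) with
  | left e => proj1_sig (cid e)
  | right _ => [::]
  end.

(* lambda_i(S), the i-th largest eigenvalue (1-indexed) *)
Definition lam n (i : nat) (S : 'M[R]_n) : R := nth 0 (eigseq S) i.-1.

Definition lam_max n (S : 'M[R]_n) : R := lam 1 S.

(* Parameters (W_1, W_2, ..., W_{L-1}, W_L) of an L-layer network with
   k = L - 2 hidden square layers: W_1 : m x dx, W_{j+2} = nWm j : m x m
   for j < k, W_L : dy x m. *)
Record netp (dx dy m k : nat) := NetP {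
  nW1 : 'M[R]_(m, dx);
  nWm : 'I_k -> 'M[R]_m;
  nWL : 'M[R]_(dy, m) }.

Definition midprod m k (Wm : 'I_k -> 'M[R]_m) : 'M[R]_m :=
  foldl (fun A j => Wm j *m A) 1%:M (enum 'I_k).

Definition netprod dx dy m k (p : netp dx dy m k) : 'M[R]_(dy, dx) :=
  nWL p *m midprod (nWm p) *m nW1 p.

Definition alpha (L m dy : nat) : R := (Num.sqrt ((m ^ L.-1 * dy)%N%:R))^-1.

Definition nloss dx dy m k n (X : 'M[R]_(dx, n)) (Y : 'M[R]_(dy, n))
  (p : netp dx dy m k) : R :=
  2^-1 * frob2 (alpha k.+2 m dy *: (netprod p *m X) - Y).

Section Grad.
Variables (dx dy m k n : nat) (X : 'M[R]_(dx, n)) (Y : 'M[R]_(dy, n)).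
Local Notation ell := (nloss X Y).

Definition grad1 (p : netp dx dy m k) : 'M[R]_(m, dx) :=
  \matrix_(a, b) derive1 (fun s : R =>
     ell (NetP (nW1 p + s *: delta_mx a b) (nWm p) (nWL p))) 0.

Definition gradm (p : netp dx dy m k) (j : 'I_k) : 'M[R]_m :=
  \matrix_(a, b) derive1 (fun s : R =>
     ell (NetP (nW1 p)
           (fun j' => if j' == j then nWm p j' + s *: delta_mx a b else nWm p j')
           (nWL p))) 0.

Definition gradL (p : netp dx dy m k) : 'M[R]_(dy, m) :=
  \matrix_(a, b) derive1 (fun s : R =>
     ell (NetP (nW1 p) (nWm p) (nWL p + s *: delta_mx a b))) 0.

Definition gd_step (eta : R) (p : netp dx dy m k) : netp dx dy m k :=
  NetP (nW1 p - eta *: grad1 p)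
       (fun j => nWm p j - eta *: gradm p j)
       (nWL p - eta *: gradL p).

Definition gd_iter (eta : R) (p0 : netp dx dy m k) (t : nat) : netp dx dy m k :=
  iter t (gd_step eta) p0.

End Grad.

(* the Borel sigma-algebra on p x q real matrices: generated by the entries *)
Definition mx_events p q : set (set 'M[R]_(p, q)) :=
  <<s [set A | exists i j (B : set R),
         measurable B /\ A = (fun M : 'M[R]_(p, q) => M i j) @^-1` B] >>.

Section Random.
Context {d : measure_display} {T : measurableType d}.

Definition random_mx p q (W : T -> 'M[R]_(p, q)) : Prop :=
  forall i j, measurable_fun setT (fun w => W w i j).

Definition rv_events p q (W : T -> 'M[R]_(p, q)) : set (set T) :=
  [set W @^-1` A | A in @mx_events p q].

Definition same_distr (P : probability T R) p q (W W' : T -> 'M[R]_(p, q)) :=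
  forall A, @mx_events p q A -> P (W @^-1` A) = P (W' @^-1` A).

End Random.

Definition orthogmx m (Q : 'M[R]_m) : Prop := Q^T *m Q = 1%:M.

End Defs.

(* Main.v *)
Require Import Defs.
From HB Require Import structures.
From mathcomp Require Import all_boot all_order all_algebra.
From mathcomp Require Import all_classical all_reals all_analysis.
From mathcomp Require Import measurable_realfun complex zify ring lra.

Set Implicit Arguments.
Unset Strict Implicit.
Unset Printing Implicit Defensive.

Import Order.TTheory GRing.Theory Num.Theory.
Import numFieldNormedType.Exports.
Local Open Scope classical_set_scope.
Local Open Scope ring_scope.

(** Orthogonal initialisation makes every product of consecutive layers an
    exact multiple of a partial isometry, so at time 0 the linearised dynamics
    of the residual E = (alpha W_L ... W_1 - W* ) X is E -> E - (eta L / dy) E X^T X.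
    As long as every layer stays within distance sqrt m / (50 L) of its initial
    value, all prefix and suffix products stay isometries up to 4%, which
    gives a contraction rate proportional to lambda_r; the higher-order part of the step is
    controlled by telescoping W'_L ... W'_1 - W_L ... W_1 over old suffixes and
    new prefixes.  Summing the geometric series of gradient norms shows that
    the layers never leave this neighbourhood, provided m dominates
    dy |X|^2 |E(0)|^2 / lambda_r^2.

    The size of E(0) is the only probabilistic input.  X is replaced by r
    vectors v_i carrying its Frobenius norm.  For a fixed vector u, the right
    invariance of W_L lets one replace u by a uniformly random sign vector, and
    a Gaussian linearisation of |W_L eps|^2 bounds its exponential moment.  The vector
    u = W_(L-1) ... W_1 v_i is random but independent of W_L; conditioning on
    it is avoided by cutting the space of (W_1, ..., W_(L-1)) into finitely
    many small boxes, on each of which u is almost constant. *)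

(** * Frobenius and operator norms *)

Section Frobenius.
Variable R : realType.

(** By the normal equations E is orthogonal to the least-squares residual, so the excess loss is
    half of |E|^2. Moreover E always has the form [Z *m X], which is why the smallest nonzero
    eigenvalue lambda_r of X^T X governs the contraction even when X^T X is singular. One smallness
    condition, 140 sqrt(dy) |X| |E(0)| <= sqrt(m) lambda_r, serves twice: it pays for the total
    displacement of the layers, and it makes the higher-order part of a step small against x = eta L
    lambda_r / dy. Sign vectors are convenient test directions because their exponential moments are
    finite sums, bounded separately for every value of W_L with orthogonal rows; right invariance
    thus takes the place of an explicit uniform measure. The number of boxes never enters the union
    bound: their probabilities sum to 1, and only the factor r, the number of vectors, remains. *)

Definition mxdot p q (A B : 'M[R]_(p, q)) : R := \sum_i \sum_j A i j * B i j.

Lemma mxdotE p q (A B : 'M[R]_(p, q)) : mxdot A B = \tr (A^T *m B).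
Proof.
rewrite /mxdot exchange_big; apply: eq_bigr => j _.
by rewrite mxE; apply: eq_bigr => i _; rewrite mxE.
Qed.

Lemma frob2E p q (A : 'M[R]_(p, q)) : frob2 A = mxdot A A.
Proof. by apply: eq_bigr => i _; apply: eq_bigr => j _; rewrite expr2. Qed.

Lemma frob2_tr p q (A : 'M[R]_(p, q)) : frob2 A^T = frob2 A.
Proof.
rewrite /frob2 exchange_big; apply: eq_bigr => j _.
by apply: eq_bigr => i _; rewrite mxE.
Qed.

Lemma frobn_tr p q (A : 'M[R]_(p, q)) : frobn A^T = frobn A.
Proof. by rewrite /frobn frob2_tr. Qed.

Lemma frob2_ge0 p q (A : 'M[R]_(p, q)) : 0 <= frob2 A.
Proof. by apply: sumr_ge0 => i _; apply: sumr_ge0 => j _; rewrite sqr_ge0. Qed.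

Lemma frobn_ge0 p q (A : 'M[R]_(p, q)) : 0 <= frobn A.
Proof. exact: sqrtr_ge0. Qed.

Lemma sqr_frobn p q (A : 'M[R]_(p, q)) : frobn A ^+ 2 = frob2 A.
Proof. by rewrite sqr_sqrtr // frob2_ge0. Qed.

Lemma mxdotC p q (A B : 'M[R]_(p, q)) : mxdot A B = mxdot B A.
Proof. by apply: eq_bigr => i _; apply: eq_bigr => j _; rewrite mulrC. Qed.

Lemma mxdotDr p q (A B C : 'M[R]_(p, q)) :
  mxdot A (B + C) = mxdot A B + mxdot A C.
Proof. by rewrite !mxdotE mulmxDr mxtraceD. Qed.

Lemma mxdotZr p q a (A B : 'M[R]_(p, q)) : mxdot A (a *: B) = a * mxdot A B.
Proof. by rewrite !mxdotE -scalemxAr mxtraceZ. Qed.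

Lemma mxdotDl p q (A B C : 'M[R]_(p, q)) :
  mxdot (B + C) A = mxdot B A + mxdot C A.
Proof. by rewrite mxdotC mxdotDr !(mxdotC A). Qed.

Lemma mxdotZl p q a (A B : 'M[R]_(p, q)) : mxdot (a *: A) B = a * mxdot A B.
Proof. by rewrite mxdotC mxdotZr mxdotC. Qed.

Lemma mxdotNr p q (A B : 'M[R]_(p, q)) : mxdot A (- B) = - mxdot A B.
Proof. by rewrite -scaleN1r mxdotZr mulN1r. Qed.

Lemma mxdot0r p q (A : 'M[R]_(p, q)) : mxdot A 0 = 0.
Proof. by rewrite -(scale0r 0) mxdotZr mul0r. Qed.

Lemma mxdot_sumr p q I (r : seq I) (P : pred I) (A : 'M[R]_(p, q)) F :
  mxdot A (\sum_(i <- r | P i) F i) = \sum_(i <- r | P i) mxdot A (F i).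
Proof.
elim/big_rec2: _ => [|i x y _ <-]; first exact: mxdot0r.
by rewrite mxdotDr.
Qed.

Lemma mxdot_mull p q s (A : 'M[R]_(p, q)) (B : 'M[R]_(q, s)) C :
  mxdot (A *m B) C = mxdot B (A^T *m C).
Proof. by rewrite !mxdotE trmx_mul mulmxA. Qed.

Lemma mxdot_mulr p q s (A : 'M[R]_(p, q)) (B : 'M[R]_(q, s)) C :
  mxdot (A *m B) C = mxdot A (C *m B^T).
Proof. by rewrite !mxdotE trmx_mul -mulmxA mxtrace_mulC mulmxA. Qed.

Lemma frob2D p q (A B : 'M[R]_(p, q)) :
  frob2 (A + B) = frob2 A + 2 * mxdot A B + frob2 B.
Proof. by rewrite !frob2E mxdotDr !mxdotDl (mxdotC B A); ring. Qed.

Lemma frob2Z p q a (A : 'M[R]_(p, q)) : frob2 (a *: A) = a ^+ 2 * frob2 A.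
Proof. by rewrite !frob2E mxdotZr mxdotZl mulrA expr2. Qed.

Lemma frob2N p q (A : 'M[R]_(p, q)) : frob2 (- A) = frob2 A.
Proof. by rewrite -scaleN1r frob2Z sqrrN expr1n mul1r. Qed.

Lemma frob2B p q (A B : 'M[R]_(p, q)) :
  frob2 (A - B) = frob2 A - 2 * mxdot A B + frob2 B.
Proof. by rewrite frob2D frob2N mxdotNr; ring. Qed.

Lemma frobnZ p q a (A : 'M[R]_(p, q)) : frobn (a *: A) = `|a| * frobn A.
Proof. by rewrite /frobn frob2Z sqrtrM ?sqr_ge0 // sqrtr_sqr. Qed.

Lemma frobnN p q (A : 'M[R]_(p, q)) : frobn (- A) = frobn A.
Proof. by rewrite /frobn frob2N. Qed.

Lemma frobnBC p q (A B : 'M[R]_(p, q)) : frobn (A - B) = frobn (B - A).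
Proof. by rewrite -frobnN opprB. Qed.

Lemma frob2_eq0 p q (A : 'M[R]_(p, q)) : (frob2 A == 0) = (A == 0).
Proof.
apply/eqP/eqP => [A0|->]; last by rewrite frob2E mxdot0r.
have row0 i : \sum_j A i j ^+ 2 = 0.
  apply: (psumr_eq0P _ A0) => // k _.
  by apply: sumr_ge0 => j _; rewrite sqr_ge0.
apply/matrixP => i j; apply/eqP; rewrite mxE -sqrf_eq0; apply/eqP.
by apply: (psumr_eq0P _ (row0 i)) => // k _; rewrite sqr_ge0.
Qed.

Lemma frobn_eq0 p q (A : 'M[R]_(p, q)) : (frobn A == 0) = (A == 0).
Proof. by rewrite -sqrf_eq0 sqr_frobn frob2_eq0. Qed.

Lemma frobn0 p q : frobn (0 : 'M[R]_(p, q)) = 0.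
Proof. by apply/eqP; rewrite frobn_eq0. Qed.

Lemma mxdot_le p q (A B : 'M[R]_(p, q)) : mxdot A B <= frobn A * frobn B.
Proof.
have [->|A0] := eqVneq A 0; first by rewrite mxdotC mxdot0r frobn0 mul0r.
have [->|B0] := eqVneq B 0; first by rewrite mxdot0r frobn0 mulr0.
have a0 : 0 < frobn A by rewrite lt_def frobn_eq0 A0 frobn_ge0.
have b0 : 0 < frobn B by rewrite lt_def frobn_eq0 B0 frobn_ge0.
(* Expanded, this square is 2|A||B| (|A||B| - <A,B>). *)
have := frob2_ge0 (frobn B *: A - frobn A *: B).
rewrite frob2B !frob2Z mxdotZr mxdotZl -!sqr_frobn => h.
have ab0 : 0 < frobn A * frobn B by rewrite mulr_gt0.
by rewrite -(ler_pM2l ab0); lra.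
Qed.

Lemma frobnD p q (A B : 'M[R]_(p, q)) : frobn (A + B) <= frobn A + frobn B.
Proof.
rewrite -ler_sqr ?nnegrE ?addr_ge0 ?frobn_ge0 // sqr_frobn frob2D.
by rewrite -!sqr_frobn; have := mxdot_le A B; nra.
Qed.

Lemma frobn_sum p q I (r : seq I) (P : pred I) (F : I -> 'M[R]_(p, q)) :
  frobn (\sum_(i <- r | P i) F i) <= \sum_(i <- r | P i) frobn (F i).
Proof.
elim/big_rec2: _ => [|i x y _ h]; first by rewrite frobn0.
by apply: le_trans (frobnD _ _) _; rewrite lerD2l.
Qed.

Lemma frob2_mul_le p q s (A : 'M[R]_(p, q)) (B : 'M[R]_(q, s)) :
  frob2 (A *m B) <= frob2 A * frob2 B.
Proof.
rewrite -(frob2_tr B) {2 3}/frob2 mulr_suml; apply: ler_sum => i _.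
rewrite mulr_sumr; apply: ler_sum => j _.
have rowE (k : nat) (M : 'M[R]_(k, q)) l : \sum_j0 M l j0 ^+ 2 = frob2 (row l M).
  by rewrite /frob2 big_ord1; apply: eq_bigr => ? _; rewrite mxE.
rewrite !rowE; set u := row _ A; set v := row _ B^T.
have -> : (A *m B) i j = mxdot u v.
  by rewrite mxE /mxdot big_ord1; apply: eq_bigr => k _; rewrite !mxE.
rewrite -!sqr_frobn -exprMn -ler_sqrt ?sqr_ge0 // !sqrtr_sqr.
rewrite [leRHS]ger0_norm ?mulr_ge0 ?frobn_ge0 // ler_norml mxdot_le andbT.
by rewrite lerNl -mxdotNr -(frobnN v) mxdot_le.
Qed.

Lemma frobnM p q s (A : 'M[R]_(p, q)) (B : 'M[R]_(q, s)) :
  frobn (A *m B) <= frobn A * frobn B.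
Proof.
rewrite -ler_sqr ?nnegrE ?mulr_ge0 ?frobn_ge0 // exprMn !sqr_frobn.
exact: frob2_mul_le.
Qed.

Lemma frob2_cols p q (A : 'M[R]_(p, q)) : frob2 A = \sum_j frob2 (col j A).
Proof.
rewrite /frob2 exchange_big; apply: eq_bigr => j _; apply: eq_bigr => i _.
by rewrite big_ord1 mxE.
Qed.

Lemma frob2_scaled_isom p q s (A : 'M[R]_(p, q)) (a : R) (Z : 'M[R]_(q, s)) :
  A^T *m A = a%:M -> frob2 (A *m Z) = a * frob2 Z.
Proof. by move=> hA; rewrite !frob2E mxdot_mull mulmxA hA mul_scalar_mx mxdotZr. Qed.

(* [c] bounds the operator norm of [A] *)
Definition opb p q (A : 'M[R]_(p, q)) (c : R) : Prop :=
  forall s (Z : 'M[R]_(q, s)), frobn (A *m Z) <= c * frobn Z.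

Lemma opb_frobn p q (A : 'M[R]_(p, q)) : opb A (frobn A).
Proof. by move=> s Z; exact: frobnM. Qed.

Lemma opb_le p q (A : 'M[R]_(p, q)) c c' : opb A c -> c <= c' -> opb A c'.
Proof.
move=> hA cc' s Z; apply: le_trans (hA _ _) _.
by rewrite ler_wpM2r // frobn_ge0.
Qed.

Lemma opbM p q s (A : 'M[R]_(p, q)) (B : 'M[R]_(q, s)) a b :
  0 <= a -> opb A a -> opb B b -> opb (A *m B) (a * b).
Proof.
move=> a0 hA hB t Z; rewrite -mulmxA; apply: le_trans (hA _ _) _.
by rewrite -mulrA ler_wpM2l.
Qed.

Lemma opbD p q (A B : 'M[R]_(p, q)) a b : opb A a -> opb B b -> opb (A + B) (a + b).
Proof.
move=> hA hB t Z; rewrite mulmxDl mulrDl.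
by apply: le_trans (frobnD _ _) _; rewrite lerD.
Qed.

Lemma opb_isom p q (A : 'M[R]_(p, q)) a :
  0 <= a -> A^T *m A = (a ^+ 2)%:M -> opb A a.
Proof.
move=> a0 hA s Z; rewrite -ler_sqr ?nnegrE ?mulr_ge0 ?frobn_ge0 //.
by rewrite exprMn !sqr_frobn (frob2_scaled_isom _ hA).
Qed.

(** |A^T Z|^2 = <Z, A A^T Z> is at most |Z| c |A^T Z|; divide by |A^T Z|. *)
Lemma opb_tr p q (A : 'M[R]_(p, q)) c : 0 <= c -> opb A c -> opb A^T c.
Proof.
move=> c0 hA s Z; have [->|AZ0] := eqVneq (A^T *m Z) 0.
  by rewrite frobn0 mulr_ge0 ?frobn_ge0.
have n0 : 0 < frobn (A^T *m Z) by rewrite lt_def frobn_eq0 AZ0 frobn_ge0.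
rewrite -(ler_pM2r n0) -expr2 sqr_frobn frob2E mxdot_mull trmxK.
apply: le_trans (mxdot_le _ _) _.
by rewrite mulrAC mulrC ler_wpM2r ?frobn_ge0.
Qed.

Lemma opb_mulr p q s (A : 'M[R]_(p, q)) c (Z : 'M[R]_(s, p)) :
  0 <= c -> opb A c -> frobn (Z *m A) <= c * frobn Z.
Proof.
by move=> c0 hA; rewrite -frobn_tr trmx_mul -(frobn_tr Z); apply: opb_tr.
Qed.

Let unit_image p q (A : 'M[R]_(p, q)) :=
  [set frobn (A *m v) | v in [set v : 'cV[R]_q | frobn v <= 1]].

Let unit_image_sup p q (A : 'M[R]_(p, q)) : has_sup (unit_image A).
Proof.
split.
  by exists (frobn (A *m (0 : 'cV[R]_q))); exists 0 => //=; rewrite frobn0.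
exists (frobn A) => _ [v /= v1 <-]; apply: le_trans (frobnM _ _) _.
by rewrite ler_piMr ?frobn_ge0.
Qed.

Lemma specn_ge0 p q (A : 'M[R]_(p, q)) : 0 <= specn A.
Proof.
have : unit_image A (frobn (A *m (0 : 'cV[R]_q))) by exists 0 => //=; rewrite frobn0.
by move/(ub_le_sup (proj2 (unit_image_sup A))); rewrite mulmx0 frobn0.
Qed.

(** The supremum over the unit ball controls all vectors by homogeneity, and then all matrices
    column by column, squared Frobenius norms being additive over columns. *)
Lemma opb_specn p q (A : 'M[R]_(p, q)) : opb A (specn A).
Proof.
have hv (v : 'cV[R]_q) : frobn (A *m v) <= specn A * frobn v.
  have [->|v0] := eqVneq v 0; first by rewrite mulmx0 !frobn0 mulr0.
  have n0 : 0 < frobn v by rewrite lt_def frobn_eq0 v0 frobn_ge0.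
  rewrite -ler_pdivrMr // mulrC.
  have i0 : 0 <= (frobn v)^-1 by rewrite invr_ge0 frobn_ge0.
  rewrite -{1}[(frobn v)^-1]ger0_norm // -frobnZ scalemxAr.
  apply: (ub_le_sup (proj2 (unit_image_sup A))).
  by exists ((frobn v)^-1 *: v) => //=; rewrite frobnZ ger0_norm // mulVf ?gt_eqF.
move=> s Z.
rewrite -ler_sqr ?nnegrE ?mulr_ge0 ?frobn_ge0 ?specn_ge0 // exprMn !sqr_frobn.
rewrite !(frob2_cols (_ *m _)) (frob2_cols Z) mulr_sumr; apply: ler_sum => j _.
rewrite colE -mulmxA -colE -!sqr_frobn -exprMn ler_sqr //.
  by rewrite nnegrE frobn_ge0.
by rewrite nnegrE mulr_ge0 ?frobn_ge0 ?specn_ge0.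
Qed.

Lemma specn_le p q (A : 'M[R]_(p, q)) c : 0 <= c ->
  (forall v : 'cV[R]_q, frobn (A *m v) <= c * frobn v) -> specn A <= c.
Proof.
move=> c0 hc; apply: ge_sup; first exact: (proj1 (unit_image_sup A)).
by move=> _ [v /= v1 <-]; apply: le_trans (hc v) _; rewrite ler_piMr.
Qed.

End Frobenius.

(** * The spectral theorem and the spectrum of the Gram matrix *)

Section Orthogonal.
Variable R : realType.

(* the reflection exchanging [u] and [v] *)
Lemma orthog_transitive m (u v : 'cV[R]_m) :
  frob2 u = frob2 v -> exists Q : 'M[R]_m, orthogmx Q /\ Q *m u = v.
Proof.
move=> uv; have [->|nuv] := eqVneq u v.
  by exists 1%:M; rewrite /orthogmx trmx1 !mul1mx.
pose w := u - v; have w0 : frob2 w != 0 by rewrite frob2_eq0 subr_eq0.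
have dotE (x y : 'cV[R]_m) : x^T *m y = (mxdot x y)%:M.
  by rewrite mxdotE [LHS]mx11_scalar /mxtrace big_ord1.
pose c := 2 / frob2 w; pose Q := 1%:M - c *: (w *m w^T).
have QT : Q^T = Q by rewrite /Q linearB /= linearZ /= trmx1 trmx_mul trmxK.
have ww : w *m w^T *m (w *m w^T) = frob2 w *: (w *m w^T).
  by rewrite mulmxA -(mulmxA w) dotE -frob2E mul_mx_scalar -scalemxAl.
exists Q; split.
  have cc : c * (c * frob2 w) = c + c by rewrite /c; field.
  rewrite /orthogmx QT {1}/Q mulmxBl mul1mx -scalemxAl /Q mulmxBr mulmx1.
  rewrite -scalemxAr ww scalerA scalerBr scalerA cc scalerDl opprB addrK.
  by rewrite subrK.
rewrite /Q mulmxBl mul1mx -scalemxAl -mulmxA dotE mul_mx_scalar scalerA.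
have -> : c * mxdot w u = 1.
  (* Since [u] and [v] have equal norms, <u - v, u> is half of |u - v|^2. *)
  have -> : mxdot w u = frob2 w / 2.
    rewrite /w frob2B mxdotDl -scaleN1r mxdotZl -frob2E -uv (mxdotC v).
    by field.
  by rewrite /c; field.
by rewrite scale1r /w opprB addrC subrK.
Qed.

(** An eigenvalue exists over the complex numbers. It is its own conjugate because v S v* is real
    for a real symmetric S, so it is a root of the real characteristic polynomial and has a real
    eigenvector. *)
Lemma sym_eigenvector n (S : 'M[R]_n.+1) : S^T = S ->
  exists (a : R) (v : 'cV[R]_n.+1), v != 0 /\ S *m v = a *: v.
Proof.
move=> Ssym; pose f := real_complex R; pose SC := map_mx f S.
have [a /[dup] aP /eigenvalueP[v vS v0]] := @eigenvalue_closed R[i] _ SC isT.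
have vvgt0 : 0 < \sum_j v 0 j * Num.conj (v 0 j).
  have /rV0Pn[j vj] := v0; rewrite (bigD1 j) //= ltr_wpDr //.
    by apply: sumr_ge0 => k _; rewrite mul_conjC_ge0.
  by rewrite mul_conjC_gt0.
have quadE : a * (\sum_j v 0 j * Num.conj (v 0 j)) =
    \sum_j \sum_i v 0 i * SC i j * Num.conj (v 0 j).
  rewrite mulr_sumr; apply: eq_bigr => j _.
  by have /rowP/(_ j) := vS; rewrite !mxE mulrA => <-; rewrite mulr_suml.
have aR : Num.conj a = a.
  apply: (mulIf (lt0r_neq0 vvgt0)); rewrite quadE.
  have -> : \sum_j v 0 j * Num.conj (v 0 j) = Num.conj (\sum_j v 0 j * Num.conj (v 0 j)).
    by rewrite rmorph_sum; apply: eq_bigr => j _; rewrite rmorphM /= conjCK mulrC.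
  rewrite -rmorphM quadE rmorph_sum exchange_big; apply: eq_bigr => i _ /=.
  rewrite rmorph_sum; apply: eq_bigr => j _.
  rewrite !rmorphM /= conjCK.
  have -> : Num.conj (SC j i) = SC j i.
    by rewrite mxE; apply: conj_Creal; apply/complex_realP; exists (S j i).
  by rewrite !mxE -[in RHS]Ssym mxE mulrAC [_ * v 0 i]mulrC mulrAC.
have /complex_realP[r ar] : a \is Num.real by apply/CrealP.
move: aP; rewrite eigenvalue_root_char ar -map_char_poly fmorph_root.
rewrite -eigenvalue_root_char => /eigenvalueP[u uS u0].
exists r, u^T; split; first by rewrite trmx_eq0.
by rewrite -[S]Ssym -trmx_mul uS linearZ.
Qed.

(** Deflation: an orthogonal matrix [H] sends the first basis vector to a unit eigenvector;
    conjugating by [H] splits off a 1 x 1 block, and symmetry clears the rest of the first row. *)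
Theorem real_spectral n (S : 'M[R]_n) : S^T = S ->
  exists (Q : 'M[R]_n) (d : 'rV[R]_n), orthogmx Q /\ S = Q^T *m diag_mx d *m Q.
Proof.
elim: n S => [|n IH] S Ssym.
  by exists 1%:M, 0; split; [rewrite /orthogmx trmx1 mul1mx | rewrite flatmx0 [RHS]flatmx0].
have [a [v [v0 Sv]]] := sym_eigenvector Ssym.
pose e : 'cV[R]_n.+1 := delta_mx 0 0.
have nv0 : frobn v != 0 by rewrite frobn_eq0.
have [H [HO He]] : exists H : 'M[R]_n.+1, orthogmx H /\ H *m e = (frobn v)^-1 *: v.
  apply: orthog_transitive; rewrite frob2Z -(sqr_frobn v) exprVn mulVf ?sqrf_eq0 //.
  rewrite /frob2 (bigD1 ord0) //= big_ord1 [X in _ + X]big1 ?mxE /= ?expr1n ?addr0 //.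
  by move=> i i0; rewrite big_ord1 mxE (negbTE i0) expr0n.
have HOr : H *m H^T = 1%:M by apply: mulmx1C.
pose S' : 'M[R]_(1 + n) := H^T *m S *m H.
have S'sym : S'^T = S' by rewrite /S' !trmx_mul trmxK Ssym mulmxA.
have S'e : S' *m e = a *: e.
  have -> : S' *m e = H^T *m (S *m (H *m e)) by rewrite !mulmxA.
  rewrite He -scalemxAr Sv scalerA mulrC -scalerA -He -scalemxAr.
  by rewrite (mulmxA H^T) HO mul1mx.
have SE : S = H *m S' *m H^T.
  by rewrite /S' !mulmxA HOr mul1mx -mulmxA HOr mulmx1.
move: S' S'sym S'e SE => S' S'sym S'e SE.
have S'0 (i : 'I_(1 + n)) : S' i (lshift n 0) = a *+ (i == lshift n 0).
  have -> : lshift n 0 = (0 : 'I_n.+1) :> 'I_(1 + n) by apply/val_inj.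
  have /matrixP/(_ i 0) := S'e; rewrite /e -colE !mxE => ->.
  by rewrite eqxx andbT mulr_natr.
pose S2 := @drsubmx R 1 n 1 n S'.
have S2sym : S2^T = S2 by rewrite /S2 trmx_drsub S'sym.
have [Q2 [d2 [Q2O S2E]]] := IH S2 S2sym.
have S'E : S' = block_mx a%:M 0 0 S2.
  rewrite -[LHS]submxK; congr block_mx.
  - by apply/matrixP => i j; rewrite !ord1 !mxE S'0 eqxx.
  - by apply/matrixP => i j; rewrite !mxE -S'sym mxE ord1 S'0 -val_eqE.
  - by apply/matrixP => i j; rewrite !mxE ord1 S'0 -val_eqE.
pose Q0 : 'M[R]_(1 + n) := block_mx 1%:M 0 0 Q2.
pose d : 'rV[R]_(1 + n) := row_mx a%:M d2.
have Q0O : Q0^T *m Q0 = 1%:M.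
  rewrite /Q0 tr_block_mx mulmx_block !trmx0 trmx1 !mul0mx !mulmx0 !mul1mx Q2O.
  by rewrite !addr0 add0r -scalar_mx_block.
have dE : diag_mx d = block_mx a%:M 0 0 (diag_mx d2).
  rewrite /d diag_mx_row; congr block_mx.
  by apply/matrixP => i j; rewrite !ord1 !mxE.
have mid : S' = Q0^T *m diag_mx d *m Q0.
  rewrite S'E dE /Q0 tr_block_mx !mulmx_block !trmx0 trmx1 S2E.
  by rewrite !(mul0mx, mulmx0, mul1mx, mulmx1, addr0, add0r).
exists (Q0 *m H^T), d; split.
  by rewrite /orthogmx trmx_mul trmxK mulmxA -(mulmxA H) Q0O mulmx1.
by rewrite SE mid trmx_mul trmxK !mulmxA.
Qed.
End Orthogonal.

Section GramSpectrum.
Variable R : realType.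

Lemma char_poly_orthog_conj n (Q D : 'M[R]_n) :
  orthogmx Q -> char_poly (Q^T *m D *m Q) = char_poly D.
Proof.
move=> QO; rewrite /char_poly.
have QQ : map_mx polyC Q^T *m map_mx polyC Q = 1%:M.
  by rewrite -map_mxM QO map_mx1.
have -> : char_poly_mx (Q^T *m D *m Q) =
    map_mx polyC Q^T *m char_poly_mx D *m map_mx polyC Q.
  rewrite /char_poly_mx mulmxBr mulmxBl !map_mxM mul_mx_scalar -scalemxAl QQ.
  by rewrite scalemx1.
by rewrite !det_mulmx mulrAC -det_mulmx QQ det1 mul1r.
Qed.

Lemma rank_diag_le n (d : 'rV[R]_n) :
  (\rank (diag_mx d) <= #|[pred i | (d 0 i != 0)%R]|)%N.
Proof.
have -> : diag_mx d = \sum_(i in [pred i | (d 0 i != 0)%R]) d 0 i *: delta_mx i i.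
  rewrite diag_mx_sum_delta [RHS]big_mkcond; apply: eq_bigr => i _.
  by rewrite inE; case: eqP => //= ->; rewrite scale0r.
rewrite -sum1_card.
elim/big_rec2: _ => [|i k M _ IH]; first by rewrite mxrank0.
apply: leq_trans (mxrank_add _ _) _; apply: leq_add => //.
by apply: leq_trans (mxrankS (scalemx_sub _ (submx_refl _))) _; rewrite mxrank_delta.
Qed.

(** For the lower bound, the identity is a diagonal matrix supported on the zeros of [d] plus a
    multiple of [diag_mx d], so [n] is at most the number of zeros plus the rank. *)
Lemma rank_diag n (d : 'rV[R]_n) :
  \rank (diag_mx d) = #|[pred i | (d 0 i != 0)%R]|.
Proof.
apply/eqP; rewrite eqn_leq rank_diag_le /=.
pose e : 'rV[R]_n := \row_i (d 0 i == 0)%:R.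
have eC : [pred i | (e 0 i != 0)%R] =i [predC [pred i | (d 0 i != 0)%R]].
  by move=> i; rewrite !inE mxE negbK; case: (d 0 i == 0); rewrite /= ?oner_eq0 ?eqxx.
have DE : diag_mx e + diag_mx d *m diag_mx (\row_i (d 0 i)^-1) = 1%:M.
  apply/matrixP => i j; rewrite mulmx_diag !mxE.
  have [->|_] := eqVneq i j; rewrite ?mulr0n ?addr0 // !mulr1n.
  by have [->|h] := eqVneq (d 0 j) 0; rewrite ?mul0r ?addr0 // add0r mulfV.
have := mxrank_add (diag_mx e) (diag_mx d *m diag_mx (\row_i (d 0 i)^-1)).
rewrite DE mxrank1 => h.
have := leq_trans h (leq_add (rank_diag_le e) (mxrankM_maxl _ _)).
by rewrite (eq_card eC) -{1}(card_ord n) -(cardC [pred i | (d 0 i != 0)%R]) addnC leq_add2l.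
Qed.

(** If K X^T X = 0 then |K X^T|^2, the trace of K X^T X K^T, vanishes; so the left kernel of X^T X
    lies in that of X^T. *)
Lemma rank_gram p q (X : 'M[R]_(p, q)) : \rank (X^T *m X) = \rank X.
Proof.
rewrite -(mxrank_tr X); apply/eqP; rewrite eqn_leq mxrankM_maxl /=.
suff : (\rank (kermx (X^T *m X)) <= \rank (kermx X^T))%N.
  rewrite !mxrank_ker; have := rank_leq_row X^T.
  by have := rank_leq_row (X^T *m X); lia.
apply: mxrankS; apply/sub_kermxP; apply/eqP; rewrite -frob2_eq0 frob2E mxdot_mulr.
by rewrite trmxK -mulmxA mulmx_ker mxdot0r.
Qed.

(** Sorting the diagonal rules out the junk branch of [eigseq]; unique factorisation of the
    characteristic polynomial then identifies the chosen sequence up to order. *)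
Lemma eigseq_conj_diag n (Q : 'M[R]_n) (d : 'rV[R]_n) :
  orthogmx Q -> let s := eigseq (Q^T *m diag_mx d *m Q) in
  sorted (fun x y : R => y <= x) s /\ perm_eq s [seq d 0 i | i <- enum 'I_n].
Proof.
move=> QO; set S := _ *m Q.
have SE : char_poly S = \prod_(x <- [seq d 0 i | i <- enum 'I_n]) ('X - x%:P).
  rewrite char_poly_orthog_conj // char_poly_trig ?diag_mx_is_trig //.
  rewrite big_map big_enum /=; apply: eq_bigr => i _.
  by rewrite mxE eqxx mulr1n.
rewrite /eigseq; case: pselect => [e|]; last first.
  case; exists (sort (fun x y : R => y <= x) [seq d 0 i | i <- enum 'I_n]).
  split; first by apply: sort_sorted => x y; exact: le_total.
  by rewrite SE; apply: perm_big; rewrite perm_sym perm_sort.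
case: (cid e) => s [ss sE] /=; split => //.
by apply: prod_XsubC_eq; rewrite -sE SE.
Qed.

Lemma nth_sorted_ge (s : seq R) i j : sorted (fun x y : R => y <= x) s ->
  (i <= j)%N -> (j < size s)%N -> nth 0 s j <= nth 0 s i.
Proof.
move=> ss ij js; apply: (sorted_leq_nth _ _ 0 ss) => //.
- by move=> x y z yx zy; apply: le_trans zy yx.
- exact: (leq_ltn_trans ij js).
Qed.

(** Zeros can only stand at the end of such a list, and the default 0 of [nth] keeps the equivalence
    true past the end. It makes eigenvalue number rank(X) the last nonzero one. *)
Lemma sorted_nonneg_count (s : seq R) :
  sorted (fun x y : R => y <= x) s -> {in s, forall x, 0 <= x} ->
  forall i, (i < count (fun x => x != 0%R) s)%N = (nth 0 s i != 0).
Proof.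
move=> ss s0 i; elim: s ss s0 i => [|x s IH] ss s0 i /=; first by rewrite nth_nil eqxx.
have IH' := IH (path_sorted ss) (fun y ys => s0 y (@mem_behead _ (x :: s) y ys)).
have [x0|x0] /= := eqVneq x 0; last by case: i => [|i] //=; rewrite add1n ltnS IH'.
have all0 y : y \in s -> y = 0.
  move=> ys; apply/eqP; rewrite eq_le s0 ?inE ?ys ?orbT // andbT -x0.
  have /allP := order_path_min (leT := fun x y : R => y <= x) (fun _ _ _ h h' => le_trans h' h) ss.
  exact.
have -> : count (fun x => x != 0) s = 0%N.
  apply/eqP; rewrite -leqn0 leqNgt -has_count; apply/hasPn => y ys.
  by rewrite (all0 _ ys) eqxx.
rewrite add0n ltn0; case: i => [|i] /=; first by rewrite x0 eqxx.
case: (ltnP i (size s)) => h; last by rewrite nth_default ?eqxx.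
by rewrite (all0 _ (mem_nth 0 h)) eqxx.
Qed.

Theorem gram_spectrum p q (X : 'M[R]_(p, q)) : X != 0 ->
  exists (Q : 'M[R]_q) (d : 'rV[R]_q),
  [/\ orthogmx Q, X^T *m X = Q^T *m diag_mx d *m Q,
      #|[pred i | (d 0 i != 0)%R]| = \rank X,
      0 < lam (\rank X) (X^T *m X) &
      forall i, 0 <= d 0 i <= lam_max (X^T *m X) /\
         (d 0 i != 0 -> lam (\rank X) (X^T *m X) <= d 0 i)].
Proof.
move=> X0; have [|Q [d [QO XE]]] := @real_spectral R _ (X^T *m X).
  by rewrite trmx_mul trmxK.
have QOr : Q *m Q^T = 1%:M by apply: mulmx1C.
(* The eigenvalues are the squared column norms of [X *m Q^T], hence nonnegative. *)
have dE : (X *m Q^T)^T *m (X *m Q^T) = diag_mx d.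
  rewrite trmx_mul trmxK mulmxA -(mulmxA Q) XE !mulmxA QOr mul1mx.
  by rewrite -mulmxA QOr mulmx1.
have d0 i : 0 <= d 0 i.
  have /matrixP/(_ i i) := dE; rewrite !mxE eqxx mulr1n => <-.
  by apply: sumr_ge0 => k _; rewrite !mxE -expr2 sqr_ge0.
have rk : #|[pred i | (d 0 i != 0)%R]| = \rank X.
  rewrite -rank_diag -(rank_gram X) XE.
  have Qu : Q \in unitmx by case: (mulmx1_unit QO).
  have QTu : Q^T \in unitmx by rewrite unitmx_tr.
  by rewrite mxrankMfree ?row_free_unit // eqmxMfull ?row_full_unit.
have [] := @eigseq_conj_diag _ Q d QO; rewrite -XE.
rewrite /lam_max /lam; set s := eigseq _ => ss sp.
have s0 : {in s, forall x, 0 <= x}.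
  by move=> x; rewrite (perm_mem sp) => /mapP[i _ ->].
have cs : count (fun x => x != 0) s = \rank X.
  rewrite (permP sp) count_map -rk -sum1_count -sum1_card big_enum_cond.
  by apply: eq_bigl => i; rewrite !inE.
have r0 : (0 < \rank X)%N by rewrite lt0n mxrank_eq0.
have rsize : ((\rank X).-1 < size s)%N.
  by rewrite prednK // -cs count_size.
have nz : nth 0 s (\rank X).-1 != 0.
  by rewrite -sorted_nonneg_count // cs prednK.
exists Q, d; split => //.
  by rewrite lt_def nz /= s0 // mem_nth.
move=> i; have : d 0 i \in s by rewrite (perm_mem sp) map_f // mem_enum.
case/(nthP 0) => j js dj; split.
  by rewrite d0 /= -dj; apply: nth_sorted_ge.
rewrite -dj -sorted_nonneg_count // cs => jr; apply: nth_sorted_ge => //.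
by rewrite -ltnS prednK.
Qed.

(** [kappa] is defined through [lam_max] while [rtilde] and the step size use [specn]; this
    inequality connects the two. *)
Lemma specn_sqr_le_lam_max p q (X : 'M[R]_(p, q)) : X != 0 ->
  specn X ^+ 2 <= lam_max (X^T *m X).
Proof.
move=> X0; have [Q [d [QO XE _ _ dP]]] := gram_spectrum X0.
have l0 : 0 <= lam_max (X^T *m X).
  case: (pickP (fun i : 'I_q => true)) => [i _|q0].
    by case: (dP i) => /andP[h0 h1] _; exact: le_trans h0 h1.
  by case/eqP: X0; apply/matrixP => i j; have := q0 j.
move: (lam_max _) dP l0 => l dP l0.
rewrite -(sqr_sqrtr l0) ler_sqr ?nnegrE ?specn_ge0 ?sqrtr_ge0 //.
apply: specn_le => [|v]; first exact: sqrtr_ge0.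
rewrite -ler_sqr ?nnegrE ?mulr_ge0 ?frobn_ge0 ?sqrtr_ge0 //.
rewrite exprMn !sqr_frobn sqr_sqrtr // frob2E mxdot_mull mulmxA XE.
have <- : frob2 (Q *m v) = frob2 v by rewrite (frob2_scaled_isom _ QO) mul1r.
rewrite -!mulmxA -mxdot_mull; set u := Q *m v.
rewrite /mxdot /frob2 mulr_sumr; apply: ler_sum => i _.
rewrite !big_ord1 mul_diag_mx !mxE mulrCA -expr2.
by apply: ler_wpM2r; [exact: sqr_ge0 | case: (dP i) => /andP[]].
Qed.

Lemma gram_col_eq0 p q (X : 'M[R]_(p, q)) (Q : 'M[R]_q) (d : 'rV[R]_q) j :
  orthogmx Q -> X^T *m X = Q^T *m diag_mx d *m Q -> d 0 j = 0 ->
  col j (X *m Q^T) = 0.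
Proof.
move=> QO XE dj; have QOr : Q *m Q^T = 1%:M by apply: mulmx1C.
apply/eqP; rewrite -frob2_eq0; apply/eqP.
have -> : frob2 (col j (X *m Q^T)) = ((X *m Q^T)^T *m (X *m Q^T)) j j.
  by rewrite mxE; apply: eq_bigr => k _; rewrite big_ord1 !mxE expr2.
rewrite trmx_mul trmxK mulmxA -(mulmxA Q) XE !mulmxA QOr mul1mx.
by rewrite -mulmxA QOr mulmx1 mxE dj mul0rn.
Qed.

(** In the eigenbasis of X^T X the coordinates of [Z *m X] vanish wherever the eigenvalue does, and
    every other eigenvalue is at least lambda_r. *)
Lemma frob2_gram_ge p q s (X : 'M[R]_(p, q)) (Z : 'M[R]_(s, p)) : X != 0 ->
  lam (\rank X) (X^T *m X) * frob2 (Z *m X) <= frob2 (Z *m X *m X^T).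
Proof.
move=> X0; have [Q [d [QO XE _ l0 dP]]] := gram_spectrum X0.
set l := lam _ _; pose E := Z *m X; pose F := E *m Q^T.
have -> : frob2 (Z *m X) = frob2 F.
  rewrite -(frob2_tr F) /F trmx_mul trmxK (frob2_scaled_isom _ (QO : _ = 1%:M)).
  by rewrite mul1r frob2_tr.
have -> : frob2 (Z *m X *m X^T) = mxdot F (F *m diag_mx d).
  rewrite frob2E mxdot_mulr trmxK -/E -mulmxA XE !mulmxA -/F.
  by rewrite mxdotC mxdot_mulr -/F mxdotC.
have F0 i j : d 0 j = 0 -> F i j = 0.
  move=> /(gram_col_eq0 QO XE) XQ0.
  have -> : F i j = (Z *m col j (X *m Q^T)) i 0.
    by rewrite /F /E -mulmxA [LHS]mxE [RHS]mxE; apply: eq_bigr => k _; rewrite [in RHS]mxE.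
  by rewrite XQ0 mulmx0 mxE.
rewrite /frob2 /mxdot mulr_sumr; apply: ler_sum => i _.
rewrite mulr_sumr; apply: ler_sum => j _.
have -> : (F *m diag_mx d) i j = F i j * d 0 j.
  by move: F {F0} => F; rewrite mul_mx_diag mxE.
rewrite mulrA -expr2 mulrC.
have [dj|dj] := eqVneq (d 0 j) 0; first by rewrite F0 // expr0n /= mul0r mul0r.
by apply: ler_wpM2l; [exact: sqr_ge0 | case: (dP j) => _; exact].
Qed.
End GramSpectrum.

(** * Products of layers *)

Section Products.
Variable R : realType.
Variables (m dx : nat).
Implicit Types (V : nat -> 'M[R]_m) (A : 'M[R]_(m, dx)).

(** The rectangular first layer is kept apart, and the square layers are indexed by [nat] so that
    inductions carry no bound proofs. *)
Fixpoint pre V A (i : nat) : 'M[R]_(m, dx) :=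
  if i is j.+1 then V j *m pre V A j else A.

Lemma eq_pre V V' A i : (forall j, (j < i)%N -> V j = V' j) -> pre V A i = pre V' A i.
Proof.
elim: i => [//|i IH] h /=; rewrite h // IH // => j ji.
by apply: h; rewrite (ltn_trans ji).
Qed.

End Products.

Lemma pre_mul (R : realType) m dx (V : nat -> 'M[R]_m) (A : 'M[R]_(m, dx)) i :
  pre V A i = pre V 1%:M i *m A.
Proof. by elim: i => [|i IH] /=; rewrite ?mul1mx // IH mulmxA. Qed.

Section ProductBounds.
Variable R : realType.
Variables (m dx : nat) (q : R).
Hypothesis q0 : 0 <= q.
Implicit Types (V : nat -> 'M[R]_m) (A : 'M[R]_(m, dx)).

Lemma pre_isom V A i : A^T *m A = (q ^+ 2)%:M ->
  (forall j, (j < i)%N -> (V j)^T *m V j = (q ^+ 2)%:M) ->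
  (pre V A i)^T *m pre V A i = ((q ^+ i.+1) ^+ 2)%:M.
Proof.
elim: i => [|i IH] hA hV /=; first by rewrite expr1.
rewrite trmx_mul mulmxA -(mulmxA _ (V i)^T) hV // mul_mx_scalar -scalemxAl.
rewrite IH // => [|j ji]; last by apply: hV; rewrite (ltn_trans ji).
by rewrite scale_scalar_mx -exprMn -exprS.
Qed.

Lemma pre_opb V A i z : 0 <= z -> opb A z -> (forall j, (j < i)%N -> opb (V j) z) ->
  opb (pre V A i) (z ^+ i.+1).
Proof.
move=> z0; elim: i => [|i IH] hA hV /=; first by rewrite expr1.
rewrite exprS; apply: opbM => //; first exact: hV.
by apply: IH => // j ji; apply: hV; rewrite (ltn_trans ji).
Qed.

(** Deviations compound like the expansion of (1 + y)^(i+1) without its constant term: each factor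
    is either an unperturbed layer, of norm at most [q], or a perturbation, of norm at most
    [q * y]. *)
Lemma pre_dev V V0 A A0 i y : 0 <= y ->
  opb A0 q -> opb (A - A0) (q * y) ->
  (forall j, (j < i)%N -> opb (V0 j) q /\ opb (V j - V0 j) (q * y)) ->
  opb (pre V A i - pre V0 A0 i) (q ^+ i.+1 * ((1 + y) ^+ i.+1 - 1)).
Proof.
move=> y0 hA0 hA; elim: i => [|i IH] hV /=.
  by apply: (opb_le hA); rewrite !expr1 addrAC subrr add0r.
have hV' j : (j < i)%N -> opb (V0 j) q /\ opb (V j - V0 j) (q * y).
  by move=> ji; apply: hV; rewrite (ltn_trans ji).
have [hV0 hdV] := hV i (leqnn _).
have -> : V i *m pre V A i - V0 i *m pre V0 A0 i =
    V0 i *m (pre V A i - pre V0 A0 i) + (V i - V0 i) *m pre V A i.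
  by rewrite mulmxBr mulmxBl [RHS]addrC addrA subrK.
have z0 : 0 <= q * (1 + y) by rewrite mulr_ge0 ?addr_ge0.
have split_opb p (B B0 : 'M[R]_(m, p)) : opb B0 q -> opb (B - B0) (q * y) -> opb B (q * (1 + y)).
  by move=> h0 h; rewrite -(subrK B0 B) mulrDr mulr1 addrC; apply: opbD.
have hP : opb (pre V A i) ((q * (1 + y)) ^+ i.+1).
  apply: pre_opb => //; first exact: split_opb hA.
  by move=> j /hV'[h0 h]; exact: split_opb h.
apply: opb_le (opbD (opbM q0 hV0 (IH hV')) (opbM (mulr_ge0 q0 y0) hdV hP)) _.
rewrite le_eqVlt; apply/orP; left; apply/eqP.
by rewrite exprMn (exprS _ i.+1) (exprS (1 + y) i.+1); ring.
Qed.

(** Replacing the layers one at a time, old ones on the left and new ones on the right, each of the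
    [i + 1] replacements costs [th] times the norms of the other [i] factors. *)
Lemma pre_step V V' A A' i z th : 0 <= z -> 0 <= th ->
  opb (A' - A) th -> opb A' z ->
  (forall j, (j < i)%N -> [/\ opb (V j) z, opb (V' j) z & opb (V' j - V j) th]) ->
  opb (pre V' A' i - pre V A i) (i.+1%:R * th * z ^+ i).
Proof.
move=> z0 th0 hA hA'; elim: i => [|i IH] hV /=.
  by rewrite expr0 mul1r mulr1.
have hV' j : (j < i)%N -> [/\ opb (V j) z, opb (V' j) z & opb (V' j - V j) th].
  by move=> ji; apply: hV; rewrite (ltn_trans ji).
have [hVi _ hdV] := hV i (leqnn _).
have -> : V' i *m pre V' A' i - V i *m pre V A i =
    V i *m (pre V' A' i - pre V A i) + (V' i - V i) *m pre V' A' i.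
  by rewrite mulmxBr mulmxBl [RHS]addrC addrA subrK.
have hP : opb (pre V' A' i) (z ^+ i.+1).
  by apply: pre_opb => // j /hV'[].
apply: opb_le (opbD (opbM z0 hVi (IH hV')) (opbM th0 hdV hP)) _.
rewrite le_eqVlt; apply/orP; left; apply/eqP.
by rewrite -[in RHS]natr1 exprS; ring.
Qed.

(** A division-free form of (1 + y)^i <= 1 / (1 - i y); in the induction, (1 + y) (1 - (i+1) y) <= 1
    - i y. *)
Lemma expr_1D_le (y : R) i : 0 <= y -> (1 + y) ^+ i * (1 - i%:R * y) <= 1.
Proof.
move=> y0; elim: i => [|i IH]; first by rewrite expr0 mul0r subr0 mulr1.
apply: le_trans IH; rewrite exprSr -natr1 -mulrA ler_wpM2l ?exprn_ge0 ?addr_ge0 //.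
by have : 0 <= i%:R :> R := ler0n _ _; nra.
Qed.
End ProductBounds.

Section Network.
Variable R : realType.
Variables (dx dy m k : nat).
Implicit Types (p : netp R dx dy m k).

(* out of range indices give the zero layer *)
Definition lay (Wm : 'I_k -> 'M[R]_m) (i : nat) : 'M[R]_m :=
  if insub i is Some j then Wm j else 0.

Lemma lay_ord Wm (j : 'I_k) : lay Wm j = Wm j.
Proof. by rewrite /lay valK. Qed.

Lemma layE Wm i (h : (i < k)%N) : lay Wm i = Wm (Ordinal h).
Proof. by rewrite -lay_ord. Qed.

Definition npre p (i : nat) : 'M[R]_(m, dx) := pre (lay (nWm p)) (nW1 p) i.

(** This is B V_(k-1) ... V_i, encoded as the transpose of a prefix product of transposed layers so
    that every bound on [pre] transfers. *)
Definition suf (V : nat -> 'M[R]_m) (B : 'M[R]_(dy, m)) (i : nat) : 'M[R]_(dy, m) :=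
  (pre (fun l => (V (k - l.+1)%N)^T) B^T (k - i))^T.

Definition nsuf p (i : nat) : 'M[R]_(dy, m) := suf (lay (nWm p)) (nWL p) i.

Lemma suf_last V B : suf V B k = B.
Proof. by rewrite /suf subnn /= trmxK. Qed.

Lemma sufS V B i : (i < k)%N -> suf V B i = suf V B i.+1 *m V i.
Proof.
move=> ik; rewrite /suf -(subnSK ik) /= trmx_mul trmxK; congr (_ *m V _); lia.
Qed.

Lemma eq_suf V V' B i : (forall j, (i <= j < k)%N -> V j = V' j) ->
  suf V B i = suf V' B i.
Proof.
move=> h; rewrite /suf; congr trmx; apply: eq_pre => j jk; rewrite h //; lia.
Qed.

Lemma suf_pre V B (A : 'M[R]_(m, dx)) i : (i <= k)%N -> suf V B i *m pre V A i = B *m pre V A k.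
Proof.
move=> ik; have [j ->] : exists j, i = (k - j)%N by exists (k - i)%N; lia.
elim: j {ik i} => [|j IH]; first by rewrite subn0 suf_last.
(* For [j >= k] truncated subtraction makes both indices 0. *)
case: (ltnP j k) => jk; last by rewrite -IH; congr (suf _ _ _ *m pre _ _ _); lia.
rewrite sufS ?subnSK //; last lia.
by rewrite -IH -(subnSK jk) /= mulmxA.
Qed.

Lemma midprodE Wm : midprod Wm = pre (lay Wm) 1%:M k.
Proof.
rewrite /midprod; have H (s : seq 'I_k) (M : 'M[R]_m) :
    foldl (fun A j => Wm j *m A) M s = foldl (fun A i => lay Wm i *m A) M (map val s).
  by elim: s M => [//|j s IH] M /=; rewrite IH lay_ord.
have H' i : foldl (fun A i => lay Wm i *m A) 1%:M (iota 0 i) = pre (lay Wm) 1%:M i.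
  by elim: i => [//|i IH]; rewrite -addn1 iotaD foldl_cat IH /= addn1.
by rewrite H val_enum_ord H'.
Qed.

Lemma netprod_pre p : netprod p = nWL p *m npre p k.
Proof. by rewrite /netprod midprodE /npre (pre_mul _ (nW1 p)) mulmxA. Qed.

Lemma netprod_split p i : (i <= k)%N -> netprod p = nsuf p i *m npre p i.
Proof. by move=> ik; rewrite netprod_pre -(suf_pre _ (nWL p) _ ik). Qed.

(* the suffixes of the old product meet the prefixes of the new one *)
Lemma netprod_telescope p p' :
  netprod p' - netprod p =
    (nWL p' - nWL p) *m npre p' k +
    \sum_(j < k) nsuf p j.+1 *m (nWm p' j - nWm p j) *m npre p' j +
    nsuf p 0 *m (nW1 p' - nW1 p).
Proof.
have -> : \sum_(j < k) nsuf p j.+1 *m (nWm p' j - nWm p j) *m npre p' j =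
    nsuf p k *m npre p' k - nsuf p 0 *m npre p' 0.
  rewrite -(telescope_sumr (fun i => nsuf p i *m npre p' i)) // big_mkord.
  apply: eq_bigr => j _; rewrite /nsuf (sufS _ _ (ltn_ord j)) /=.
  by rewrite mulmxBr mulmxBl -!lay_ord !mulmxA.
rewrite /nsuf suf_last netprod_pre (netprod_split p (leq0n k)) /npre /=.
by rewrite mulmxBl mulmxBr /nsuf !addrA addrNK addrNK.
Qed.
End Network.

(** * Gradients of the loss *)

Section Gradient.
Variable R : realType.

(** The network is affine in each single entry of a layer, so along a coordinate line the loss is a
    quadratic polynomial and its partial derivative is the linear coefficient. *)
Lemma derive1_quadratic (a b c : R) :
  derive1 (fun s : R => a + s * b + s ^+ 2 * c) 0 = b.
Proof.
have -> : (fun s : R => a + s * b + s ^+ 2 * c) =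
    horner (a%:P + b%:P * 'X + c%:P * 'X^2).
  by apply/funext => s; rewrite !hornerE /=; ring.
by rewrite -derivE !(derivD, derivM, derivC, derivX, derivXn) !hornerE /=; ring.
Qed.

Lemma derive1_loss_line p q (F0 F1 : 'M[R]_(p, q)) :
  derive1 (fun s : R => 2^-1 * frob2 (F0 + s *: F1)) 0 = mxdot F0 F1.
Proof.
rewrite -[RHS](derive1_quadratic (2^-1 * frob2 F0) _ (2^-1 * frob2 F1)).
congr (derive1 _ 0); apply/funext => s.
by rewrite frob2D frob2Z mxdotZr; field.
Qed.

Lemma mxdot_delta p q (A : 'M[R]_(p, q)) a b : mxdot A (delta_mx a b) = A a b.
Proof.
rewrite /mxdot (bigD1 a) //= (bigD1 b) //= mxE !eqxx mulr1.
rewrite big1 => [|j jb]; last by rewrite mxE (negbTE jb) andbF mulr0.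
rewrite addr0 big1 ?addr0 // => i ia; rewrite big1 // => j _.
by rewrite mxE (negbTE ia) mulr0.
Qed.

Variables (dx dy m k n : nat) (X : 'M[R]_(dx, n)) (Y : 'M[R]_(dy, n)).
Implicit Types (p : netp R dx dy m k).

Local Notation al := (alpha R k.+2 m dy).

Definition resid p : 'M[R]_(dy, n) := al *: (netprod p *m X) - Y.

(** One computation for all three gradients: the perturbed layer sits between a suffix [B] and a
    prefix [A], one of which is the identity at either end of the network. *)
Lemma loss_line_entry c d p (ps : R -> netp R dx dy m k)
    (B : 'M[R]_(dy, c)) (A : 'M[R]_(d, dx)) a b :
  (forall s, netprod (ps s) = netprod p + s *: (B *m delta_mx a b *m A)) ->
  derive1 (fun s => nloss X Y (ps s)) 0 =
    (al *: (B^T *m (resid p *m X^T) *m A^T)) a b.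
Proof.
move=> h; have -> : (fun s => nloss X Y (ps s)) =
    fun s => 2^-1 * frob2 (resid p + s *: (al *: (B *m delta_mx a b *m A *m X))).
  apply/funext => s; rewrite /nloss h; congr (_ * frob2 _).
  by rewrite mulmxDl scalerDr /resid addrAC -scalemxAl !scalerA (mulrC al).
rewrite derive1_loss_line mxdotZr mxE -mxdot_delta; congr (_ * _).
by rewrite mxdotC 2!mxdot_mulr mxdot_mull mxdotC mulmxA.
Qed.

Lemma grad1E p : grad1 X Y p = al *: ((nsuf p 0)^T *m (resid p *m X^T)).
Proof.
apply/matrixP => a b; rewrite mxE.
rewrite (@loss_line_entry _ _ p _ (nsuf p 0) 1%:M a b) ?trmx1 ?mulmx1 // => s.
by rewrite ?mulmx1 !(netprod_split _ (leq0n k)) /npre /= mulmxDr -scalemxAr.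
Qed.

Lemma gradmE p (j : 'I_k) :
  gradm X Y p j = al *: ((nsuf p j.+1)^T *m (resid p *m X^T) *m (npre p j)^T).
Proof.
apply/matrixP => a b; rewrite mxE.
rewrite (@loss_line_entry _ _ p _ (nsuf p j.+1) (npre p j) a b) // => s.
set p' := NetP _ _ _.
(* Perturbing layer [j] leaves the suffix after it and the prefix before it unchanged. *)
have ne i : i != j :> nat -> lay (nWm p') i = lay (nWm p) i.
  move=> ij; rewrite /lay; case: insubP => // i' _ vi /=.
  by rewrite -val_eqE vi (negbTE ij).
have -> : nsuf p j.+1 = nsuf p' j.+1.
  by apply: eq_suf => i ij; rewrite ne //; lia.
have -> : npre p j = npre p' j.
  by apply: eq_pre => i ij; rewrite ne //; lia.
have -> : netprod p = nsuf p' j.+1 *m nWm p j *m npre p' j.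
  rewrite (netprod_split p (ltn_ord j)) /npre /= lay_ord mulmxA.
  congr (_ *m _ *m _); first by apply: eq_suf => i ij; rewrite ne //; lia.
  by apply: eq_pre => i ij; rewrite ne //; lia.
rewrite (netprod_split p' (ltn_ord j)) /npre /= lay_ord /= eqxx mulmxDl.
by rewrite mulmxDr !mulmxA -scalemxAr -scalemxAl.
Qed.

Lemma gradLE p : gradL X Y p = al *: (resid p *m X^T *m (npre p k)^T).
Proof.
apply/matrixP => a b; rewrite mxE.
rewrite (@loss_line_entry _ _ p _ 1%:M (npre p k) a b) ?trmx1 ?mul1mx // => s.
by rewrite ?mul1mx !netprod_pre /npre /= mulmxDl -scalemxAl.
Qed.

(** Moving from [Ws] along -tD, with D = M X^T the gradient at [Ws], cannot decrease the norm; this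
    forces 2|D|^2 <= t |DX|^2 for every t > 0. *)
Lemma lsq_normal (Ws : 'M[R]_(dy, dx)) :
  (forall W : 'M[R]_(dy, dx), frobn (Ws *m X - Y) <= frobn (W *m X - Y)) ->
  (Ws *m X - Y) *m X^T = 0.
Proof.
move=> hW; set M := _ - Y; pose D := M *m X^T.
apply/eqP; rewrite -frob2_eq0 eq_le frob2_ge0 andbT -/D.
have key t : 0 < t -> 2 * frob2 D <= t * frob2 (D *m X).
  move=> t0; have := hW (Ws - t *: D).
  rewrite -ler_sqr ?nnegrE ?frobn_ge0 // !sqr_frobn.
  have -> : (Ws - t *: D) *m X - Y = M - t *: (D *m X).
    by rewrite mulmxBl -scalemxAl addrAC.
  rewrite -/M (frob2B M (t *: _)) frob2Z mxdotZr.
  have -> : mxdot M (D *m X) = frob2 D by rewrite mxdotC mxdot_mulr -/D frob2E.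
  by move=> h; rewrite -(ler_pM2l t0); nra.
have K0 := frob2_ge0 (D *m X); rewrite leNgt; apply/negP => D0.
(* The added 1 avoids division by zero; this t makes t |DX|^2 at most |D|^2, a contradiction. *)
have t0 : 0 < frob2 D / (frob2 (D *m X) + 1) by rewrite divr_gt0 // ltr_wpDl.
have := key _ t0; rewrite mulrAC ler_pdivlMr ?ltr_wpDl //; nra.
Qed.

Variable Ws : 'M[R]_(dy, dx).
Hypothesis WsP : (Ws *m X - Y) *m X^T = 0.

Definition gap p : 'M[R]_(dy, n) := (al *: netprod p - Ws) *m X.

(** All gradients see the residual only through its product with X^T, so they can be written with
    [gap]. *)
Lemma resid_gap p : resid p *m X^T = gap p *m X^T.
Proof.
rewrite /resid /gap -[RHS]addr0 -WsP -mulmxDl; congr (_ *m _).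
by rewrite mulmxBl -scalemxAl addrA subrK.
Qed.

Lemma nloss_gap p :
  nloss X Y p - 2^-1 * frob2 (Ws *m X - Y) = 2^-1 * frob2 (gap p).
Proof.
have -> : nloss X Y p = 2^-1 * frob2 (gap p + (Ws *m X - Y)).
  by congr (_ * frob2 _); rewrite /gap mulmxBl -scalemxAl addrA subrK.
by rewrite frob2D /gap mxdot_mulr WsP mxdot0r; ring.
Qed.
End Gradient.

(** * Linear convergence of gradient descent *)

Lemma rev_lt k i j : (j < k - i)%N -> (k - j.+1 < k)%N.
Proof. by lia. Qed.

Lemma rev_exp k j : (j < k)%N -> ((k - j.+1).+1 + j.+1 = k.+1)%N.
Proof. by lia. Qed.

Section Descent.
Variable R : realType.

(** The lower bound keeps gradients large relative to E, while the upper bound keeps the steps and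
    their side effects small. *)
Definition near_isom p q (A : 'M[R]_(p, q)) (a : R) : Prop :=
  opb A (26 / 25 * a) /\
  forall s (Z : 'M[R]_(q, s)), 24 / 25 * a * frobn Z <= frobn (A *m Z).

Lemma isom_near_isom p q (A A0 : 'M[R]_(p, q)) a : 0 <= a ->
  A0^T *m A0 = (a ^+ 2)%:M -> opb (A - A0) (a / 25) -> near_isom A a.
Proof.
move=> a0 hA0 hA; have hA0Z s (Z : 'M[R]_(q, s)) : frobn (A0 *m Z) = a * frobn Z.
  apply/eqP; rewrite -(eqrXn2 (n := 2)) ?mulr_ge0 ?frobn_ge0 //.
  by rewrite exprMn !sqr_frobn (frob2_scaled_isom _ hA0).
split=> s Z; have hZ := hA _ Z; rewrite mulmxBl in hZ.
  have := frobnD (A0 *m Z) (A *m Z - A0 *m Z); rewrite addrC subrK hA0Z.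
  by have := frobn_ge0 Z; lra.
have := frobnD (A0 *m Z - A *m Z) (A *m Z); rewrite subrK hA0Z frobnBC.
by have := frobn_ge0 Z; lra.
Qed.

Lemma near_isom1 p : near_isom (1%:M : 'M[R]_p) 1.
Proof. by split=> s Z; rewrite mul1mx; have := frobn_ge0 Z; lra. Qed.

Lemma sqr_sum_le N (g : 'I_N -> R) : (\sum_i g i) ^+ 2 <= N%:R * \sum_i g i ^+ 2.
Proof.
pose u : 'rV[R]_N := \row_i g i; pose v : 'rV[R]_N := const_mx 1.
have uvE : mxdot u v = \sum_i g i.
  by rewrite /mxdot big_ord1; apply: eq_bigr => i _; rewrite !mxE mulr1.
have uE : frob2 u = \sum_i g i ^+ 2.
  by rewrite /frob2 big_ord1; apply: eq_bigr => i _; rewrite !mxE.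
have vE : frob2 v = N%:R.
  rewrite /frob2 big_ord1 (eq_bigr (fun=> 1)) => [|i _]; last by rewrite mxE expr1n.
  by rewrite sumr_const card_ord.
rewrite -uvE -uE -vE -!sqr_frobn -exprMn -ler_sqrt ?sqr_ge0 // !sqrtr_sqr.
rewrite [leRHS]ger0_norm ?mulr_ge0 ?frobn_ge0 // mulrC ler_norml mxdot_le andbT.
by rewrite lerNl -mxdotNr -(frobnN v) mxdot_le.
Qed.

(** [T i] is the first-order effect of layer [i] and [g i] its gradient norm. The linear term gives
    -2 eta sum g^2; by Cauchy-Schwarz the quadratic one is at most eta^2 b^2 N sum g^2, hence 3/5
    eta sum g^2, and 7/5 = 2 - 3/5. *)
Lemma sum_terms_contract p q N (E : 'M[R]_(p, q)) (T : 'I_N -> 'M[R]_(p, q))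
    (g : 'I_N -> R) (eta b G0 : R) :
  0 <= eta -> 0 <= b -> 0 <= G0 -> eta * b ^+ 2 * N%:R <= 3 / 5 ->
  (forall i, [/\ mxdot E (T i) = g i ^+ 2, frobn (T i) <= b * g i & G0 <= g i]) ->
  frob2 (E - eta *: \sum_i T i) <= frob2 E - 7 / 5 * eta * N%:R * G0 ^+ 2.
Proof.
move=> eta0 b0 G00 hb h.
rewrite frob2B frob2Z mxdotZr mxdot_sumr.
have -> : \sum_i mxdot E (T i) = \sum_i g i ^+ 2.
  by apply: eq_bigr => i _; case: (h i).
have hT : frob2 (\sum_i T i) <= b ^+ 2 * (N%:R * \sum_i g i ^+ 2).
  rewrite -sqr_frobn; apply: (@le_trans _ _ ((b * \sum_i g i) ^+ 2)).
    rewrite ler_sqr ?nnegrE ?frobn_ge0 //; last first.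
      by rewrite mulr_ge0 // sumr_ge0 // => i _; case: (h i) => _ _; exact: le_trans.
    apply: le_trans (frobn_sum _ _ _) _; rewrite mulr_sumr.
    by apply: ler_sum => i _; case: (h i).
  by rewrite exprMn ler_wpM2l ?sqr_ge0 ?sqr_sum_le.
have hg : N%:R * G0 ^+ 2 <= \sum_i g i ^+ 2.
  rewrite -[N in N%:R]card_ord mulr_natl -sumr_const; apply: ler_sum => i _.
  by case: (h i) => _ _ gi; rewrite ler_sqr ?nnegrE // (le_trans G00).
set g2 := \sum_i g i ^+ 2 in hT hg *.
have g20 : 0 <= g2 by apply: sumr_ge0 => i _; rewrite sqr_ge0.
have h1 : eta ^+ 2 * frob2 (\sum_i T i) <= 3 / 5 * (eta * g2).
  apply: le_trans (ler_wpM2l (sqr_ge0 _) hT) _.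
  have := ler_wpM2r (mulr_ge0 eta0 g20) hb; lra.
have := ler_wpM2l eta0 hg; lra.
Qed.

(** Collects the data of the first, the last and the middle layers into one family, so that the sum
    over all layers becomes a single sum to which [sum_terms_contract] applies. *)
Definition fam k (Ty : Type) (x0 xL : Ty) (xm : 'I_k -> Ty) (i : 'I_k.+2) : Ty :=
  if unlift ord0 i is Some i' then
    if unlift ord0 i' is Some j then xm j else xL
  else x0.

Lemma fam_all k (Ty : Type) (P : Ty -> Prop) x0 xL (xm : 'I_k -> Ty) :
  P x0 -> P xL -> (forall j, P (xm j)) -> forall i, P (fam x0 xL xm i).
Proof.
by move=> h0 hL hm i; rewrite /fam; case: unlift => [i'|//]; case: unlift.
Qed.

Lemma sum_fam k (V : nmodType) (Ty : Type) (f : Ty -> V) x0 xL (xm : 'I_k -> Ty) :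
  \sum_i f (fam x0 xL xm i) = f x0 + (f xL + \sum_j f (xm j)).
Proof.
rewrite (bigD1_ord ord0) //= /fam unlift_none; congr (_ + _).
rewrite (bigD1_ord ord0) //= liftK unlift_none; congr (_ + _).
by apply: eq_bigr => j _; rewrite !liftK.
Qed.

Variables (dx dy m k n : nat) (X : 'M[R]_(dx, n)) (Y : 'M[R]_(dy, n)).
Variable Ws : 'M[R]_(dy, dx).
Hypothesis WsP : (Ws *m X - Y) *m X^T = 0.
Hypotheses (dy0 : (0 < dy)%N) (m0 : (0 < m)%N).
Variables sg la eta : R.
Hypotheses (sg0 : 0 <= sg) (Xsg : opb X sg).
Hypotheses (la0 : 0 < la) (la_sg : la <= sg ^+ 2).
Hypothesis Xla : forall Z : 'M[R]_(dy, dx),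
  la * frob2 (Z *m X) <= frob2 (Z *m X *m X^T).
Hypotheses (eta0 : 0 < eta) (eta_le : eta * k.+2%:R * sg ^+ 2 <= dy%:R / 2).

Let q : R := Num.sqrt m%:R.
Let s : R := Num.sqrt dy%:R.
Let al : R := alpha R k.+2 m dy.
Let len : R := k.+2%:R.
(** Bounds a layer's gradient relative to |E|, and the first-order change it causes relative to the
    gradient; one factor 26/25 for the suffix and one for the prefix. *)
Let b : R := (26 / 25) ^+ 2 * sg / s.
Let x : R := eta * len * la / dy%:R.

Let q0 : 0 < q. Proof. by rewrite sqrtr_gt0 ltr0n. Qed.
Let s0 : 0 < s. Proof. by rewrite sqrtr_gt0 ltr0n. Qed.
Let s2 : s ^+ 2 = dy%:R. Proof. by rewrite sqr_sqrtr. Qed.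
Let len0 : 0 < len. Proof. by rewrite ltr0n. Qed.
Let al0 : 0 <= al. Proof. by rewrite invr_ge0 sqrtr_ge0. Qed.
Let b0 : 0 <= b.
Proof.
apply: divr_ge0; last exact: ltW.
by apply: mulr_ge0 => //; apply: exprn_ge0; lra.
Qed.

(** A suffix and a prefix around one layer contain [k + 1] layers of scale [q] in total; after
    multiplication by [alpha] only 1 / sqrt(dy) is left. *)
Let alq : al * q ^+ k.+1 = s^-1.
Proof.
rewrite /al /alpha natrM natrX sqrtrM ?exprn_ge0 // -/s.
have -> : Num.sqrt (m%:R ^+ k.+1) = q ^+ k.+1 :> R.
  rewrite -[LHS]ger0_norm ?sqrtr_ge0 // -[m%:R in LHS](@sqr_sqrtr R) //.
  by rewrite -exprM mulnC exprM sqrtr_sqr normr_id ger0_norm // exprn_ge0 // ltW.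
by field; rewrite !gt_eqF // exprn_gt0.
Qed.

(** [u] is the gradient of the layer between [B] and [A]. The linear map u -> T is the adjoint of E
    -> u, so <E, T> is exactly |u|^2. *)
Lemma term_bounds c d (B : 'M[R]_(dy, c)) (A : 'M[R]_(d, dx)) be a
    (E : 'M[R]_(dy, n)) : 0 <= be -> 0 <= a -> al * (be * a) = s^-1 ->
  near_isom B^T be -> near_isom A a ->
  let u := al *: (B^T *m (E *m X^T) *m A^T) in
  let T := al *: (B *m u *m A *m X) in
  [/\ mxdot E T = frobn u ^+ 2, frobn T <= b * frobn u,
      (24 / 25) ^+ 2 / s * frobn (E *m X^T) <= frobn u &
      frobn u <= b * frobn E].
Proof.
move=> be0 a0 ha [B1 B2] [A1 A2] u T.
have be'0 : 0 <= 26 / 25 * be by rewrite mulr_ge0 // divr_ge0.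
have a'0 : 0 <= 26 / 25 * a by rewrite mulr_ge0 // divr_ge0.
have uE : frobn u = al * frobn (B^T *m (E *m X^T) *m A^T).
  by rewrite frobnZ ger0_norm.
have sE : s^-1 = al * (be * a) by [].
split.
- rewrite /T mxdotZr mxdotC 2!mxdot_mulr mxdot_mull -mxdotZr.
  by rewrite sqr_frobn frob2E; congr mxdot; rewrite /u !mulmxA.
- rewrite /T frobnZ ger0_norm // /b sE.
  apply: le_trans (ler_wpM2l al0 (opb_mulr _ sg0 Xsg)) _.
  apply: le_trans (ler_wpM2l al0 (ler_wpM2l sg0 (opb_mulr _ a'0 A1))) _.
  have hB : frobn (B *m u) <= 26 / 25 * be * frobn u.
    by rewrite -{1}(trmxK B); apply: (opb_tr be'0 B1).
  apply: le_trans (ler_wpM2l al0 (ler_wpM2l sg0 (ler_wpM2l a'0 hB))) _.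
  by rewrite le_eqVlt; apply/orP; left; apply/eqP; ring.
- rewrite uE sE; have h1 := B2 _ (E *m X^T).
  have h2 := A2 _ (B^T *m (E *m X^T))^T; rewrite frobn_tr -(frobn_tr (A *m _)) in h2.
  rewrite trmx_mul trmxK in h2.
  have h3 : 24 / 25 * a * (24 / 25 * be * frobn (E *m X^T)) <=
      frobn (B^T *m (E *m X^T) *m A^T).
    apply: le_trans h2; apply: ler_wpM2l => //.
    by rewrite mulr_ge0 // divr_ge0.
  by have := ler_wpM2l al0 h3; lra.
- rewrite uE /b sE.
  have h1 := B1 _ (E *m X^T).
  have h2 : frobn (E *m X^T) <= sg * frobn E.
    by apply: opb_mulr => //; apply: opb_tr.
  have h3 : frobn (B^T *m (E *m X^T) *m A^T) <= 26 / 25 * a * frobn (B^T *m (E *m X^T)).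
    by apply: opb_mulr => //; apply: opb_tr.
  have h4 := le_trans h3 (ler_wpM2l a'0 (le_trans h1 (ler_wpM2l be'0 h2))).
  by have := ler_wpM2l al0 h4; lra.
Qed.

Variable p0 : netp R dx dy m k.
Hypotheses (W10 : (nW1 p0)^T *m nW1 p0 = m%:R%:M)
  (Wm0 : forall j, (nWm p0 j)^T *m nWm p0 j = m%:R%:M)
  (Wm0' : forall j, nWm p0 j *m (nWm p0 j)^T = m%:R%:M)
  (WL0 : nWL p0 *m (nWL p0)^T = m%:R%:M).

Definition near (p : netp R dx dy m k) (y : R) : Prop :=
  [/\ frobn (nW1 p - nW1 p0) <= q * y,
      forall j, frobn (nWm p j - nWm p0 j) <= q * y &
      frobn (nWL p - nWL p0) <= q * y].

Let y : R := (50 * len)^-1.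
Let y0 : 0 <= y. Proof. by rewrite invr_ge0 mulr_ge0 // ltW. Qed.
Let mq : m%:R = q ^+ 2 :> R. Proof. by rewrite sqr_sqrtr. Qed.

(** With i y <= 1/50, [expr_1D_le] gives 50/49, which is below 26/25. *)
Let growth i : (i <= k.+2)%N -> (1 + y) ^+ i <= 26 / 25.
Proof.
move=> ik; have h := expr_1D_le i y0.
have iy : i%:R * y <= 50^-1.
  rewrite /y invfM mulrCA ler_piMr // ler_pdivrMr // mul1r.
  by rewrite /len ler_nat.
have : 0 <= (1 + y) ^+ i by rewrite exprn_ge0 // addr_ge0.
by nra.
Qed.

Let dev i : (i <= k.+2)%N -> q ^+ i * ((1 + y) ^+ i - 1) <= q ^+ i / 25.
Proof.
by move=> ik; rewrite ler_wpM2l ?exprn_ge0 ?(ltW q0) //; have := growth ik; lra.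
Qed.

Lemma npre_near p i : near p y -> (i <= k)%N -> near_isom (npre p i) (q ^+ i.+1).
Proof.
case=> h1 hm _ ik; apply: (@isom_near_isom _ _ _ (npre p0 i)).
- by rewrite exprn_ge0 // ltW.
- apply: pre_isom; rewrite ?W10 ?mq // => j ji.
  by rewrite (layE _ (leq_trans ji ik)) Wm0 mq.
apply: opb_le (pre_dev (ltW q0) y0 _ _ _) (dev _); last by rewrite ltnS ltnW.
- by apply: opb_isom; rewrite ?(ltW q0) // W10 mq.
- by apply: opb_le h1; exact: opb_frobn.
move=> j ji; rewrite !(layE _ (leq_trans ji ik)); split.
  by apply: opb_isom; rewrite ?(ltW q0) // Wm0 mq.
by apply: opb_le (hm _); exact: opb_frobn.
Qed.

Lemma nsuf_near p i : near p y -> (i <= k)%N ->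
  near_isom (nsuf p i)^T (q ^+ (k - i).+1).
Proof.
case=> _ hm hL ik; rewrite /nsuf /suf trmxK.
apply: (@isom_near_isom _ _ _ (nsuf p0 i)^T); rewrite /nsuf /suf ?trmxK.
- by rewrite exprn_ge0 // ltW.
- apply: pre_isom; rewrite ?trmxK ?WL0 ?mq // => j ji.
  have jk := rev_lt ji.
  by rewrite (layE _ jk) trmxK Wm0' mq.
apply: opb_le (pre_dev (ltW q0) y0 _ _ _) (dev _); last by rewrite ltnS (leq_trans (leq_subr _ _)).
- by apply: opb_isom; rewrite ?(ltW q0) // trmxK WL0 mq.
- by apply: opb_le hL; rewrite -linearB -frobn_tr; exact: opb_frobn.
move=> j ji; have jk := rev_lt ji.
rewrite !(layE _ jk); split.
  by apply: opb_isom; rewrite ?(ltW q0) // trmxK Wm0' mq.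
by apply: opb_le (hm (Ordinal jk)); rewrite -linearB -frobn_tr; exact: opb_frobn.
Qed.
Let E (p : netp R dx dy m k) := gap X Ws p.
Let U (p : netp R dx dy m k) c d (B : 'M[R]_(dy, c)) (A : 'M[R]_(d, dx)) :=
  al *: (B^T *m (E p *m X^T) *m A^T).
Let TT (p : netp R dx dy m k) c d (B : 'M[R]_(dy, c)) (A : 'M[R]_(d, dx)) :=
  al *: (B *m U p B A *m A *m X).

Lemma gd_step_incr p (p' := gd_step X Y eta p) :
  [/\ nW1 p' - nW1 p = - (eta *: U p (nsuf p 0) 1%:M),
      forall j : 'I_k,
        nWm p' j - nWm p j = - (eta *: U p (nsuf p j.+1) (npre p j)) &
      nWL p' - nWL p = - (eta *: U p 1%:M (npre p k))].
Proof.
rewrite /p' /gd_step /U /=; split=> [|j|]; rewrite addrC addKr.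
- by rewrite grad1E (resid_gap WsP) trmx1 mulmx1.
- by rewrite gradmE (resid_gap WsP).
- by rewrite gradLE (resid_gap WsP) trmx1 mul1mx.
Qed.

Lemma layer_terms p : near p y ->
  let ok c d (B : 'M[R]_(dy, c)) (A : 'M[R]_(d, dx)) :=
    [/\ mxdot (E p) (TT p B A) = frobn (U p B A) ^+ 2,
        frobn (TT p B A) <= b * frobn (U p B A),
        (24 / 25) ^+ 2 / s * frobn (E p *m X^T) <= frobn (U p B A) &
        frobn (U p B A) <= b * frobn (E p)] in
  [/\ ok _ _ (nsuf p 0) 1%:M, forall j : 'I_k, ok _ _ (nsuf p j.+1) (npre p j) &
      ok _ _ 1%:M (npre p k)].
Proof.
move=> hp ok; have q0' i : 0 <= q ^+ i by rewrite exprn_ge0 // ltW.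
split=> [|j|].
- apply: (term_bounds (E p) (q0' k.+1) ler01).
  + by rewrite mulr1.
  + by have := nsuf_near hp (leq0n k); rewrite subn0.
  + exact: near_isom1.
- apply: (term_bounds (E p) (q0' (k - j.+1).+1) (q0' j.+1)).
  + by rewrite -exprD rev_exp.
  + by apply: nsuf_near.
  + by apply: npre_near => //; rewrite ltnW.
- apply: (term_bounds (E p) ler01 (q0' k.+1)).
  + by rewrite mul1r.
  + by rewrite trmx1; exact: near_isom1.
  + exact: npre_near.
Qed.

Lemma step_size p (p' := gd_step X Y eta p) : near p y ->
  [/\ frobn (nW1 p' - nW1 p) <= eta * (b * frobn (E p)),
      forall j, frobn (nWm p' j - nWm p j) <= eta * (b * frobn (E p)) &
      frobn (nWL p' - nWL p) <= eta * (b * frobn (E p))].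
Proof.
move=> /layer_terms[[_ _ _ h1] hm [_ _ _ hL]].
have [-> hm' ->] := gd_step_incr p.
split=> [|j|]; rewrite ?hm' frobnN frobnZ (gtr0_norm eta0).
- by apply: (ler_wpM2l (ltW eta0)).
- by case: (hm j) => _ _ _ h; apply: (ler_wpM2l (ltW eta0)).
- by apply: (ler_wpM2l (ltW eta0)).
Qed.

Let layer_opb a c (W W0 : 'M[R]_(a, c)) :
  W0^T *m W0 = m%:R%:M -> frobn (W - W0) <= q * y -> opb W (q * (1 + y)).
Proof.
move=> h0 h; rewrite -(subrK W0 W) mulrDr mulr1 addrC.
apply: opbD; first by apply: opb_isom; rewrite ?(ltW q0) // h0 mq.
exact: opb_le (@opb_frobn _ _ _ _) h.
Qed.

Lemma npre_step p (p' := gd_step X Y eta p) i : near p y -> near p' y -> (i <= k)%N ->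
  opb (npre p' i - npre p i)
    (26 / 25 * len * (eta * (b * frobn (E p))) * q ^+ i).
Proof.
move=> hp hp' ik; have [d1 dm _] := step_size hp.
set th := eta * _ in d1 dm *.
have th0 : 0 <= th by apply: mulr_ge0; [exact: ltW | rewrite mulr_ge0 ?frobn_ge0].
have [n1 nm _] := hp; have [n1' nm' _] := hp'.
have z0 : 0 <= q * (1 + y) by rewrite mulr_ge0 ?addr_ge0 ?(ltW q0).
apply: opb_le (pre_step z0 th0 _ _ _) _.
- exact: opb_le (@opb_frobn _ _ _ _) d1.
- exact: layer_opb n1'.
- move=> j ji; rewrite !(layE _ (leq_trans ji ik)); split.
  + exact: layer_opb (nm _).
  + exact: layer_opb (nm' _).
  + exact: opb_le (@opb_frobn _ _ _ _) (dm _).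
have h1 : i.+1%:R <= len by rewrite ler_nat ltnS ltnW.
have h2 := growth (leq_trans ik (leq_trans (leqnSn k) (leqnSn k.+1))).
have qi : 0 <= th * q ^+ i by rewrite mulr_ge0 // exprn_ge0 // ltW.
have h3 : i.+1%:R * (1 + y) ^+ i <= len * (26 / 25).
  by apply: ler_pM => //; rewrite exprn_ge0 // addr_ge0.
by rewrite exprMn; have := ler_wpM2r qi h3; lra.
Qed.

(** What remains of [netprod_telescope] after new prefixes are replaced by old ones. The first layer
    contributes nothing, as no prefix stands to its right. *)
Let rem (p : netp R dx dy m k) (p' := gd_step X Y eta p) :=
  (nWL p' - nWL p) *m (npre p' k - npre p k) +
  \sum_(j < k) nsuf p j.+1 *m (nWm p' j - nWm p j) *m (npre p' j - npre p j).

Lemma gap_step_eq p : E (gd_step X Y eta p) =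
  E p - eta *: (TT p (nsuf p 0) 1%:M + (TT p 1%:M (npre p k) +
     \sum_(j < k) TT p (nsuf p j.+1) (npre p j))) + al *: (rem p *m X).
Proof.
have [d1 dm dL] := gd_step_incr p; set p' := gd_step X Y eta p in d1 dm dL *.
have -> : E p' = E p + al *: ((netprod p' - netprod p) *m X).
  rewrite /E /gap scalemxAl -mulmxDl; congr (_ *m _).
  by rewrite scalerBr [RHS]addrC addrA subrK.
rewrite -addrA; congr (_ + _).
have -> : netprod p' - netprod p = rem p +
   ((nWL p' - nWL p) *m npre p k +
    \sum_(j < k) nsuf p j.+1 *m (nWm p' j - nWm p j) *m npre p j +
    nsuf p 0 *m (nW1 p' - nW1 p)).
  rewrite netprod_telescope /rem -/p' addrA; congr (_ + _).
  rewrite addrACA -mulmxDr subrK; congr (_ + _).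
  rewrite -big_split; apply: eq_bigr => j _ /=.
  by rewrite -mulmxDr subrK.
rewrite mulmxDl scalerDr addrC; congr (_ + _).
rewrite d1 dL !mulmxDl !scalerDr !opprD [LHS]addrC /TT; congr (_ + (_ + _)).
- by rewrite !mulmxN !mulNmx scalerN mulmx1 -scalemxAr -scalemxAl !scalerA mulrC.
- by rewrite mul1mx !mulNmx scalerN -!scalemxAl !scalerA mulrC.
- rewrite mulmx_suml !scaler_sumr -sumrN; apply: eq_bigr => j _; rewrite dm.
  by rewrite mulmxN !mulNmx scalerN -scalemxAr -!scalemxAl !scalerA mulrC.
Qed.

Lemma rem_le p : near p y -> near (gd_step X Y eta p) y ->
  frobn (rem p) <= len * ((26 / 25) ^+ 2 * len * (eta * (b * frobn (E p))) ^+ 2 * q ^+ k).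
Proof.
move=> hp hp'; have [_ dm dL] := step_size hp.
have hP i := npre_step hp hp' (i := i).
rewrite /rem; set p' := gd_step X Y eta p in dm dL hP *.
set th := eta * _ in dm dL hP *.
have th0 : 0 <= th by apply: mulr_ge0; [exact: ltW | rewrite mulr_ge0 ?frobn_ge0].
clearbody th; have q0' i : 0 <= q ^+ i by rewrite exprn_ge0 // ltW.
have c0 i : 0 <= 26 / 25 * len * th * q ^+ i.
  by rewrite !mulr_ge0 ?invr_ge0 ?(ltW len0).
(* A common bound for the [k + 1] summands: one 26/25 comes from the change of the prefix, the other
   from the suffix. *)
set K := (26 / 25) ^+ 2 * _ * _ * _.
have K0 : 0 <= K by rewrite /K !mulr_ge0 // ?(ltW len0) ?sqr_ge0 // exprn_ge0.
have hL : frobn ((nWL p' - nWL p) *m (npre p' k - npre p k)) <= K.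
  apply: le_trans (opb_mulr _ (c0 k) (hP k (leqnn k))) _.
  apply: le_trans (ler_wpM2l (c0 k) dL) _.
  have : 0 <= len * th ^+ 2 * q ^+ k by rewrite !mulr_ge0 // ?(ltW len0) ?sqr_ge0.
  by rewrite /K; lra.
have hm (j : 'I_k) : frobn (nsuf p j.+1 *m (nWm p' j - nWm p j) *m
    (npre p' j - npre p j)) <= K.
  apply: le_trans (opb_mulr _ (c0 j) (hP j (ltnW (ltn_ord j)))) _.
  have [hS _] := nsuf_near hp (ltn_ord j).
  have a0 : 0 <= 26 / 25 * q ^+ (k - j.+1).+1 by rewrite mulr_ge0 // divr_ge0.
  have h1 := opb_tr a0 hS (nWm p' j - nWm p j); rewrite trmxK in h1.
  apply: le_trans (ler_wpM2l (c0 j) (le_trans h1 (ler_wpM2l a0 (dm j)))) _.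
  have qq : q ^+ k = q ^+ j * q ^+ (k - j.+1).+1.
    by rewrite -exprD subnSK // subnKC // ltnW.
  by rewrite /K qq le_eqVlt; apply/orP; left; apply/eqP; ring.
apply: le_trans (frobnD _ _) _.
apply: le_trans (lerD hL (frobn_sum _ _ _)) _.
apply: (@le_trans _ _ (K + \sum_(j < k) K)); first by rewrite lerD2l ler_sum.
by rewrite sumr_const card_ord -mulrS -mulr_natl ler_wpM2r // ler_nat.
Qed.

Let x0 : 0 < x.
Proof. by rewrite /x divr_gt0 ?ltr0n // !mulr_gt0. Qed.

Let x_le : x <= 2^-1.
Proof.
rewrite /x ler_pdivrMr ?ltr0n //; apply: le_trans (_ : _ <= eta * len * sg ^+ 2) _.
  by rewrite ler_wpM2l // mulr_ge0 // ltW.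
by rewrite (mulrC 2^-1).
Qed.

Lemma gap_step_le p : near p y -> near (gd_step X Y eta p) y ->
  140 * s * sg * frobn (E p) <= q * la ->
  frobn (E (gd_step X Y eta p)) <= (1 - 2 / 5 * x) * frobn (E p).
Proof.
move=> hp hp' he; set e := frobn (E p) in he *.
have e0 : 0 <= e := frobn_ge0 _.
have [t1 tm tL] := layer_terms hp.
(* The squared norm shrinks by the factor 1 - 7/5 (24/25)^4 x, which is at most 1 - 1.18 x and so at
   most (1 - 59/100 x)^2. *)
have hmain : frobn (E p - eta *: (TT p (nsuf p 0) 1%:M + (TT p 1%:M (npre p k) +
     \sum_(j < k) TT p (nsuf p j.+1) (npre p j)))) <= (1 - 59 / 100 * x) * e.
  pose G0 := (24 / 25) ^+ 2 / s * frobn (E p *m X^T).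
  pose F := fam (TT p (nsuf p 0) 1%:M, frobn (U p (nsuf p 0) 1%:M))
     (TT p 1%:M (npre p k), frobn (U p 1%:M (npre p k)))
     (fun j : 'I_k => (TT p (nsuf p j.+1) (npre p j),
                       frobn (U p (nsuf p j.+1) (npre p j)))).
  rewrite -(sum_fam fst (TT p (nsuf p 0) 1%:M, frobn (U p (nsuf p 0) 1%:M))
     (TT p 1%:M (npre p k), frobn (U p 1%:M (npre p k)))
     (fun j : 'I_k => (TT p (nsuf p j.+1) (npre p j),
                       frobn (U p (nsuf p j.+1) (npre p j))))) -/F.
  have G00 : 0 <= G0.
    apply: mulr_ge0 (frobn_ge0 _); apply: divr_ge0 (ltW s0); exact: sqr_ge0.
  (* The step size condition gives (26/25)^4 / 2, which is below 3/5. *)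
  have hb : eta * b ^+ 2 * k.+2%:R <= 3 / 5.
    have -> : eta * b ^+ 2 * k.+2%:R =
        (26 / 25) ^+ 4 * (eta * k.+2%:R * sg ^+ 2 / dy%:R).
      by rewrite /b -s2; field; rewrite gt_eqF.
    have : eta * k.+2%:R * sg ^+ 2 / dy%:R <= 2^-1.
      by rewrite ler_pdivrMr ?ltr0n // (mulrC 2^-1).
    lra.
  have hF i : [/\ mxdot (E p) (F i).1 = (F i).2 ^+ 2, frobn (F i).1 <= b * (F i).2 &
      G0 <= (F i).2].
    move: i; apply: (fam_all (P := fun t => [/\ mxdot (E p) t.1 = t.2 ^+ 2,
      frobn t.1 <= b * t.2 & G0 <= t.2])); last by move=> j; case: (tm j).
    - by case: t1.
    - by case: tL.
  have := sum_terms_contract (ltW eta0) b0 G00 hb hF.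
  have G02 : (24 / 25) ^+ 4 / dy%:R * (la * e ^+ 2) <= G0 ^+ 2.
    have -> : G0 ^+ 2 = (24 / 25) ^+ 4 / dy%:R * frob2 (E p *m X^T).
      by rewrite /G0 exprMn sqr_frobn -s2; field; rewrite gt_eqF.
    apply: ler_wpM2l; first by rewrite divr_ge0 // exprn_ge0 // divr_ge0.
    by rewrite sqr_frobn; apply: Xla.
  have xe : eta * k.+2%:R * ((24 / 25) ^+ 4 / dy%:R * (la * e ^+ 2)) =
      (24 / 25) ^+ 4 * (x * e ^+ 2) by rewrite /x /len; ring.
  have el0 : 0 <= eta * k.+2%:R by rewrite mulr_ge0 // ltW.
  have := ler_wpM2l el0 G02; rewrite xe => h1 h2.
  rewrite -ler_sqr ?nnegrE ?frobn_ge0 //; last first.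
    by apply: mulr_ge0 => //; have := x_le; lra.
  rewrite sqr_frobn; apply: le_trans h2 _; rewrite -sqr_frobn -/e.
  have xe0 : 0 <= x * e ^+ 2 by rewrite mulr_ge0 ?sqr_ge0 // ltW.
  have xe1 : 0 <= (x * e) ^+ 2 by exact: sqr_ge0.
  by lra.
(* The smallness of E yields (26/25)^6 / 280 in place of 1/10. What is left of the rate, 59/100 -
   1/10, still exceeds 2/5. *)
have hrem : frobn (al *: (rem p *m X)) <= x / 10 * e.
  rewrite frobnZ ger0_norm //.
  have h1 := le_trans (opb_mulr _ sg0 Xsg) (ler_wpM2l sg0 (rem_le hp hp')).
  apply: le_trans (ler_wpM2l al0 h1) _; rewrite -/e.
  have sq : al * q ^+ k = (s * q)^-1.
    by apply: (mulIf (lt0r_neq0 q0)); rewrite -mulrA -exprSr alq; field; rewrite !gt_eqF.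
  have -> : al * (sg * (len * ((26 / 25) ^+ 2 * len * (eta * (b * e)) ^+ 2 * q ^+ k))) =
     (26 / 25) ^+ 6 * (eta * len * sg ^+ 2 / s ^+ 2) * (sg * e * s / q) *
       (eta * len * e / s ^+ 2).
    transitivity (al * q ^+ k * (sg * (len * ((26 / 25) ^+ 2 * len * (eta * (b * e)) ^+ 2)))).
      by ring.
    by rewrite sq /b; field; rewrite !gt_eqF.
  have h2 : eta * len * sg ^+ 2 / s ^+ 2 <= 2^-1.
    by rewrite s2 ler_pdivrMr ?ltr0n // (mulrC 2^-1).
  have h2' : 0 <= eta * len * sg ^+ 2 / s ^+ 2.
    by rewrite divr_ge0 ?sqr_ge0 // !mulr_ge0 ?(ltW len0) // ltW.
  have h3 : sg * e * s / q <= la / 140.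
    by rewrite ler_pdivrMr //; lra.
  have h3' : 0 <= sg * e * s / q by rewrite divr_ge0 ?(ltW q0) // !mulr_ge0 // ltW.
  have h4 : 0 <= eta * len * e / s ^+ 2.
    by rewrite divr_ge0 ?sqr_ge0 // !mulr_ge0 // ltW.
  have h5 := ler_pM h2' h3' h2 h3.
  have -> : x / 10 * e = la / 10 * (eta * len * e / s ^+ 2) by rewrite /x s2; ring.
  apply: ler_wpM2r => //; rewrite -mulrA.
  by move: h5; set t := _ * _ => h5; lra.
rewrite gap_step_eq; apply: le_trans (frobnD _ _) _.
by have := lerD hmain hrem; have := mulr_ge0 (ltW x0) e0; lra.
Qed.

Theorem gd_linear_rate (t : nat) : 140 * s * sg * frobn (E p0) <= q * la ->
  nloss X Y (gd_iter X Y eta p0 t) - 2^-1 * frob2 (Ws *m X - Y) <=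
  (1 - 2^-1 * eta * k.+2%:R * la / dy%:R) ^+ t *
    (nloss X Y p0 - 2^-1 * frob2 (Ws *m X - Y)).
Proof.
move=> he0; pose rho := 1 - 2 / 5 * x; set e0 := frobn (E p0) in he0 *.
have e00 : 0 <= e0 := frobn_ge0 _.
have rho0 : 0 <= rho by rewrite /rho; have := x0; have := x_le; lra.
have rho1 : rho <= 1 by rewrite /rho; have := x0; have := x_le; lra.
(* The radius [y * (1 - rho ^+ i)] is a partial geometric sum: it grows with [i] but never reaches
   [y], which keeps all the near-isometry bounds available. *)
have inv i : near (gd_iter X Y eta p0 i) (y * (1 - rho ^+ i)) /\
    frobn (E (gd_iter X Y eta p0 i)) <= rho ^+ i * e0.
  elim: i => [|i [hn hE]].
    rewrite expr0 mul1r subrr mulr0; split => //.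
    by split=> [|j|]; rewrite subrr frobn0 mulr0.
  have -> : gd_iter X Y eta p0 i.+1 = gd_step X Y eta (gd_iter X Y eta p0 i) by [].
  set p := gd_iter X Y eta p0 i in hn hE *.
  have ri0 : 0 <= rho ^+ i by rewrite exprn_ge0.
  have ri1 : rho ^+ i <= 1 by rewrite exprn_ile1.
  have weak r p1 : 0 <= r -> near p1 (y * (1 - r)) -> near p1 y.
    move=> r0; have hw : q * (y * (1 - r)) <= q * y.
      by rewrite ler_wpM2l ?(ltW q0) // ler_piMr //; lra.
    by case=> h1 hm hL; split=> [|j|]; apply: le_trans hw.
  have hn' := weak _ _ ri0 hn.
  have [d1 dm dL] := step_size hn'.
  have inc : q * (y * (1 - rho ^+ i)) + eta * (b * frobn (E p)) <=
      q * (y * (1 - rho ^+ i.+1)).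
    have h1 : eta * (b * frobn (E p)) <= eta * (b * (rho ^+ i * e0)).
      by apply: (ler_wpM2l (ltW eta0)); apply: ler_wpM2l.
    (* After division by [rho ^+ i], the growth of the radius must pay for one step. The right side
       is eta q la / (125 dy), the 125 being 50 * 5 / 2, and 140 is large enough that (26/25)^2 /
       140 <= 1 / 125. *)
    suff h2 : eta * (b * e0) <= q * (y * (2 / 5 * x)).
      have -> : rho ^+ i.+1 = (1 - 2 / 5 * x) * rho ^+ i by rewrite exprS.
      by move: h1 (ler_wpM2r ri0 h2); move: (rho ^+ i) (frobn (E p)) => r e; lra.
    have -> : q * (y * (2 / 5 * x)) = eta / s ^+ 2 * (q * la / 125).
      rewrite /y /x -s2; field; rewrite !gt_eqF //.
    have -> : eta * (b * e0) = eta / s ^+ 2 * ((26 / 25) ^+ 2 * (s * sg * e0)).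
      by rewrite /b; field; rewrite !gt_eqF.
    apply: ler_wpM2l; first by rewrite divr_ge0 ?sqr_ge0 // ltW.
    have : 0 <= s * sg * e0 by rewrite !mulr_ge0 // ltW.
    by lra.
  have hs : near (gd_step X Y eta p) (y * (1 - rho ^+ i.+1)).
    have [n1 nm nL] := hn.
    have tri a c (W W' W0 : 'M[R]_(a, c)) : frobn (W' - W) <= eta * (b * frobn (E p)) ->
        frobn (W - W0) <= q * (y * (1 - rho ^+ i)) ->
        frobn (W' - W0) <= q * (y * (1 - rho ^+ i.+1)).
      move=> h1 h2; apply: le_trans inc; rewrite -(subrK W W') -addrA.
      by apply: le_trans (frobnD _ _) _; rewrite [leRHS]addrC; apply: lerD.
    by split=> [|j|]; [exact: tri d1 n1 | exact: tri (dm j) (nm j) | exact: tri dL nL].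
  split=> //; have hs' := weak _ _ (exprn_ge0 i.+1 rho0) hs.
  apply: le_trans (gap_step_le hn' hs' _) _.
    apply: le_trans he0; apply: ler_wpM2l; first by rewrite !mulr_ge0 // ltW.
    by apply: le_trans hE _; rewrite ler_piMl.
  by rewrite exprS -[leRHS]mulrA; apply: (ler_wpM2l rho0).
have [_ hE] := inv t.
rewrite !(nloss_gap WsP) -/(E _) -/(E p0) mulrCA ler_wpM2l ?invr_ge0 //.
rewrite -!sqr_frobn -/e0.
apply: (@le_trans _ _ ((rho ^+ t * e0) ^+ 2)).
  by rewrite ler_sqr ?nnegrE ?frobn_ge0 // mulr_ge0 ?exprn_ge0.
rewrite exprMn -exprM mulnC exprM; apply: ler_wpM2r; first exact: sqr_ge0.
apply: lerXn2r; rewrite ?nnegrE ?sqr_ge0 //.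
  have -> : 2^-1 * eta * k.+2%:R * la / dy%:R = x / 2 by rewrite /x /len; ring.
  by have := x_le; lra.
have -> : 2^-1 * eta * k.+2%:R * la / dy%:R = x / 2 by rewrite /x /len; ring.
(* (1 - 2/5 x)^2 <= 1 - x/2 because x <= 1/2. *)
by rewrite /rho; have := x0; have := x_le; nra.
Qed.
End Descent.

(** * Exponential moments of sign vectors *)

Section SignChaos.
Variable R : realType.

Lemma expR_le_inv (x : R) : x < 1 -> expR x <= (1 - x)^-1.
Proof.
move=> x1; rewrite -[x in expR x]opprK expRN lef_pV2 ?posrE ?expR_gt0 ?subr_gt0 //.
exact: expR_ge1Dx.
Qed.

Lemma inv_le_expR (w : R) : w < 1 -> (1 - w)^-1 <= expR (w / (1 - w)).
Proof.
move=> w1; apply: le_trans (expR_ge1Dx _); rewrite le_eqVlt; apply/orP; left.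
by apply/eqP; field; rewrite subr_eq0 gt_eqF.
Qed.

(** For |x| >= 1 use |x| <= x^2. Otherwise exp z <= (1 - z/2)^(-2) turns the sum into 2 (1 + w) / (1
    - w)^2 with w = x^2 / 4, and w < 1/4 bounds this by 2 exp(11 w / 3). *)
Lemma expR_sym_le (x : R) : expR x + expR (- x) <= 2 * expR (x ^+ 2).
Proof.
have [x1|x1] := lerP 1 `|x|.
  have h (z : R) : `|z| = `|x| -> expR z <= expR (x ^+ 2).
    move=> zx; rewrite ler_expR; apply: le_trans (ler_norm z) _.
    by rewrite zx -(real_normK (num_real x)) expr2 ler_peMr.
  by have := lerD (h x erefl) (h (- x) (normrN x)); lra.
have x2 : x ^+ 2 < 1 by rewrite -(real_normK (num_real x)) expr_lt1.
have [xl xr] : - 1 < x /\ x < 1 by move: x1; rewrite ltr_norml => /andP[].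
pose w := x ^+ 2 / 4.
have w0 : 0 <= w by rewrite divr_ge0 ?sqr_ge0.
have w4 : w < 1 / 4 by rewrite /w; lra.
have half (z : R) : expR z = expR (z / 2) ^+ 2 by rewrite -expRM_natl mulrC divfK.
have sq (z : R) : z < 1 -> expR z <= (1 - z / 2)^-1 ^+ 2.
  move=> z1; rewrite (half z) ler_sqr ?nnegrE ?expR_ge0 ?invr_ge0 //; last by lra.
  by apply: expR_le_inv; lra.
have xl' : - x < 1 by rewrite ltrNl.
apply: le_trans (lerD (sq x xr) (sq (- x) xl')) _.
have -> : (1 - x / 2)^-1 ^+ 2 + (1 - - x / 2)^-1 ^+ 2 = 2 * ((1 + w) * (1 - w)^-1 ^+ 2).
  rewrite /w; field; rewrite ?gt_eqF //=; nra.
rewrite ler_pM2l //; apply: (@le_trans _ _ (expR w * expR (4 / 3 * w) ^+ 2)).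
  apply: ler_pM; rewrite ?exprn_ge0 ?invr_ge0 ?expR_ge1Dx //; try lra.
  rewrite ler_sqr ?nnegrE ?expR_ge0 ?invr_ge0 //; last lra.
  apply: le_trans (inv_le_expR (_ : w < 1)) _; first lra.
  by rewrite ler_expR ler_pdivrMr; nra.
rewrite -expRM_natl -expRD ler_expR /w; have := sqr_ge0 x; lra.
Qed.

Definition signv m (e : {ffun 'I_m -> bool}) : 'cV[R]_m := \col_i (-1) ^+ e i.

(** The sum over all sign vectors factors into one two-term sum per coordinate. *)
Lemma sum_sign_expR m (a : 'cV[R]_m) :
  \sum_(e : {ffun 'I_m -> bool}) expR (mxdot a (signv e)) <= 2 ^+ m * expR (frob2 a).
Proof.
have dotE (v w : 'cV[R]_m) : mxdot v w = \sum_i v i 0 * w i 0.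
  by apply: eq_bigr => i _; rewrite big_ord1.
have -> : \sum_(e : {ffun 'I_m -> bool}) expR (mxdot a (signv e)) =
    \prod_i \sum_(b : bool) expR (a i 0 * (-1) ^+ b).
  rewrite bigA_distr_bigA; apply: eq_bigr => e _ /=.
  by rewrite dotE expR_sum; apply: eq_bigr => i _; rewrite mxE.
rewrite frob2E dotE expR_sum -[m in 2 ^+ m]card_ord -prodr_const -big_split /=.
apply: ler_prod => i _; rewrite sumr_ge0 => [|b _]; last exact: expR_ge0.
rewrite big_bool /= expr0 expr1 mulr1 mulrN1 addrC -expr2.
exact: expR_sym_le.
Qed.

Local Notation mu := (@lebesgue_measure R).

Lemma gauss_linear (t : R) :
  (\int[mu]_g (normal_pdf 0 1 g * expR (t * g))%:E = (expR (t ^+ 2 / 2))%:E)%E.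
Proof.
transitivity (\int[mu]_g ((expR (t ^+ 2 / 2))%:E * (normal_pdf t 1 g)%:E))%E.
  apply: eq_integral => g _; rewrite -EFinM; congr EFin.
  rewrite !normal_pdfE ?oner_eq0 // mulrCA -mulrA; congr (_ * _).
  rewrite /normal_fun -!expRD; congr expR.
  by rewrite expr1n -mulr_natr mul1r; field.
rewrite ge0_integralZl_EFin ?expR_ge0 //.
- by rewrite integral_normal_pdf mule1.
- by move=> g _; rewrite lee_fin normal_pdf_ge0.
- by apply/measurable_EFinP; exact: measurable_normal_pdf.
Qed.

(** Completing the square: the weight exp(g^2 / 4) turns the standard Gaussian into one of variance
    2 and mean 2t, and sqrt 2 is the ratio of the normalisations. *)
Lemma gauss_quadratic (t : R) :
  (\int[mu]_g (normal_pdf 0 1 g * expR (t * g + g ^+ 2 / 4))%:E =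
   (Num.sqrt 2 * expR (t ^+ 2))%:E)%E.
Proof.
have s2 : Num.sqrt 2 != 0 :> R by rewrite gt_eqF // sqrtr_gt0.
transitivity (\int[mu]_g ((Num.sqrt 2 * expR (t ^+ 2))%:E *
    (normal_pdf (2 * t) (Num.sqrt 2) g)%:E))%E.
  apply: eq_integral => g _; rewrite -EFinM; congr EFin.
  rewrite !normal_pdfE ?oner_eq0 //.
  have -> : normal_peak (1 : R) = Num.sqrt 2 * normal_peak (Num.sqrt (2 : R)).
    rewrite /normal_peak sqr_sqrtr // expr1n mul1r -(mulrnAr 2) sqrtrM // invfM.
    by rewrite mulrA mulfV // mul1r.
  rewrite [RHS]mulrACA -!mulrA; congr (_ * (_ * _)).
  rewrite /normal_fun -!expRD; congr expR.
  rewrite sqr_sqrtr // expr1n -[2 *+ 2]mulr_natr -[1 *+ 2]/(2 : R).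
  by field.
rewrite ge0_integralZl_EFin ?mulr_ge0 ?sqrtr_ge0 ?expR_ge0 //.
- by rewrite integral_normal_pdf mule1.
- by move=> g _; rewrite lee_fin normal_pdf_ge0.
- by apply/measurable_EFinP; exact: measurable_normal_pdf.
Qed.

(* Gaussian linearisation of the squares reduces the chaos to [sum_sign_expR]. *)
Lemma sign_chaos_le m (bs : seq 'cV[R]_m) (a : 'cV[R]_m) :
  (forall b, b \in bs -> frob2 b = 1) -> pairwise (fun u v => mxdot u v == 0) bs ->
  \sum_(e : {ffun 'I_m -> bool})
     expR (mxdot a (signv e) + 8^-1 * \sum_(b <- bs) mxdot b (signv e) ^+ 2) <=
  2 ^+ m * Num.sqrt 2 ^+ size bs *
    expR (frob2 a + \sum_(b <- bs) mxdot a b ^+ 2).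
Proof.
elim: bs a => [|b bs IH] a hn.
  move=> _; rewrite expr0 mulr1 big_nil addr0.
  under eq_bigr do rewrite big_nil mulr0 addr0.
  exact: sum_sign_expR.
rewrite pairwise_cons => /andP[/allP hb hp].
have hn' v : v \in bs -> frob2 v = 1 by move=> vb; apply: hn; rewrite inE vb orbT.
have b1 : frob2 b = 1 by apply: hn; rewrite inE eqxx.
pose h (e : {ffun 'I_m -> bool}) :=
  expR (mxdot a (signv e) + 8^-1 * \sum_(v <- bs) mxdot v (signv e) ^+ 2).
pose y (e : {ffun 'I_m -> bool}) := mxdot b (signv e).
pose A := 2 ^+ m * Num.sqrt 2 ^+ size bs * expR (frob2 a + \sum_(v <- bs) mxdot a v ^+ 2).
have A0 : 0 <= A by rewrite !mulr_ge0 ?expR_ge0 ?exprn_ge0 ?sqrtr_ge0.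
have mexp0 (t : R) : measurable_fun setT (fun g : R => normal_pdf 0 1 g * expR (t * g)).
  apply: measurable_funM; first exact: measurable_normal_pdf.
  by apply: measurableT_comp => //; apply: measurable_funM.
have mexp (c t : R) : measurable_fun setT (fun g : R => c * (normal_pdf 0 1 g * expR (t * g))).
  exact: measurable_funM.
rewrite -lee_fin.
(* The square of the head vector is linearised by exp(y^2 / 8) = E_g exp(y g / 2). *)
have -> : (\sum_(e : {ffun 'I_m -> bool}) expR (mxdot a (signv e) +
      8^-1 * \sum_(v <- b :: bs) mxdot v (signv e) ^+ 2))%:E =
    (\int[mu]_g (\sum_(e : {ffun 'I_m -> bool})
       (h e * (normal_pdf 0 1 g * expR (y e / 2 * g)))%:E))%E.
  rewrite ge0_integral_sum //; last 2 first.
  - by move=> e; apply/measurable_EFinP; exact: mexp.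
  - by move=> e g _; rewrite lee_fin !mulr_ge0 ?expR_ge0 ?normal_pdf_ge0.
  rewrite -sumEFin; apply: eq_bigr => e _.
  under eq_integral do rewrite EFinM.
  rewrite ge0_integralZl_EFin ?expR_ge0 //.
  - rewrite gauss_linear -EFinM; congr EFin; rewrite /h -expRD big_cons.
    by congr expR; rewrite /y; field.
  - by move=> g _; rewrite lee_fin mulr_ge0 ?expR_ge0 ?normal_pdf_ge0.
  - by apply/measurable_EFinP; exact: mexp0.
(* For fixed g the induction hypothesis is applied to a + (g/2) b. Since |a + (g/2) b|^2 = |a|^2 + g
   <a,b> + g^2 / 4, integrating over g costs a factor sqrt 2 and adds <a,b>^2 to the exponent. *)
apply: (@le_trans _ _ (\int[mu]_g (A%:E *
    (normal_pdf 0 1 g * expR (mxdot a b * g + g ^+ 2 / 4))%:E)))%E; last first.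
  rewrite ge0_integralZl_EFin //.
  - rewrite gauss_quadratic -EFinM lee_fin le_eqVlt; apply/orP; left; apply/eqP.
    rewrite /A /= big_cons (exprSr _ (size bs)).
    have -> : frob2 a + (mxdot a b ^+ 2 + \sum_(j <- bs) mxdot a j ^+ 2) =
      (frob2 a + \sum_(j <- bs) mxdot a j ^+ 2) + mxdot a b ^+ 2 by ring.
    by rewrite (expRD (frob2 a + _) (mxdot a b ^+ 2)); ring.
  - by move=> g _; rewrite lee_fin mulr_ge0 ?expR_ge0 ?normal_pdf_ge0.
  - apply/measurable_EFinP; apply: measurable_funM; first exact: measurable_normal_pdf.
    apply: measurableT_comp => //; apply: measurable_funD; first exact: measurable_funM.
    by apply: measurable_funM => //; exact: exprn_measurable.
apply: ge0_le_integral => //.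
- move=> g _; apply: sume_ge0 => e _.
  by rewrite lee_fin !mulr_ge0 ?expR_ge0 ?normal_pdf_ge0.
- by apply: emeasurable_sum => e; apply/measurable_EFinP; exact: mexp.
- apply: measurable_funeM; apply/measurable_EFinP.
  apply: measurable_funM; first exact: measurable_normal_pdf.
  apply: measurableT_comp => //; apply: measurable_funD; first exact: measurable_funM.
  by apply: measurable_funM => //; exact: exprn_measurable.
move=> g _; rewrite sumEFin -EFinM lee_fin.
have -> : \sum_(e : {ffun 'I_m -> bool}) h e * (normal_pdf 0 1 g * expR (y e / 2 * g)) =
   normal_pdf 0 1 g * \sum_(e : {ffun 'I_m -> bool})
     expR (mxdot (a + (g / 2) *: b) (signv e) +
           8^-1 * \sum_(v <- bs) mxdot v (signv e) ^+ 2).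
  rewrite mulr_sumr; apply: eq_bigr => e _; rewrite mulrCA; congr (_ * _).
  rewrite /h -expRD; congr expR; rewrite mxdotDl mxdotZl /y; ring.
rewrite mulrCA ler_wpM2l ?normal_pdf_ge0 //; apply: le_trans (IH _ hn' hp) _.
rewrite le_eqVlt; apply/orP; left; apply/eqP.
(* Orthogonality of [b] to the remaining vectors hides the shift from them. *)
have -> : \sum_(v <- bs) mxdot (a + (g / 2) *: b) v ^+ 2 = \sum_(v <- bs) mxdot a v ^+ 2.
  apply: eq_big_seq => v vb; rewrite mxdotDl mxdotZl.
  by have /eqP -> := hb v vb; rewrite mulr0 addr0.
rewrite /A -!mulrA -expRD; congr (_ * (_ * expR _)).
by rewrite frob2D frob2Z mxdotZr b1; field.
Qed.
End SignChaos.

(** * Tail of |W u|^2 for a random W with orthogonal rows *)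

Section StiefelTail.
Variable R : realType.

Lemma random_mx_frob2 d (T : measurableType d) p q s (W : T -> 'M[R]_(p, q))
    (u : 'M[R]_(q, s)) : random_mx W ->
  measurable_fun setT (fun w => frob2 (W w *m u)).
Proof.
move=> hW; apply: measurable_sum => i; apply: measurable_sum => j.
apply: (measurableT_comp (exprn_measurable 2)).
under eq_fun do rewrite mxE.
by apply: measurable_sum => l; apply: measurable_funM => //; exact: hW.
Qed.

Lemma mx_events_measurable p q (A : set (g_sigma_algebraType
    [set A : set 'M[R]_(p, q) | exists i j (B : set R),
         measurable B /\ A = (fun M : 'M[R]_(p, q) => M i j) @^-1` B])) :
  measurable A -> @mx_events R p q A.
Proof. by []. Qed.

(** Seen as a random matrix on its own sigma-algebra, the identity turns measurability of functions
    of a random matrix into measurability of sets of matrices. *)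
Lemma random_mx_id p q : random_mx (fun M : g_sigma_algebraType
    [set A : set 'M[R]_(p, q) | exists i j (B : set R),
         measurable B /\ A = (fun M : 'M[R]_(p, q) => M i j) @^-1` B] => M).
Proof.
move=> i j _ B mB; rewrite setTI; apply: sub_sigma_algebra.
by exists i, j, B.
Qed.

Lemma mx_events_frob2_gt p q (u : 'cV[R]_q) c :
  @mx_events R p q [set M | c < frob2 (M *m u)].
Proof.
apply: mx_events_measurable.
have := random_mx_frob2 u (@random_mx_id p q) measurableT (measurable_itv `]c, +oo[).
rewrite setTI; congr measurable; apply/seteqP.
by split=> M /=; rewrite in_itv /= andbT.
Qed.

Lemma frob2_signv m (e : {ffun 'I_m -> bool}) : frob2 (signv R e) = m%:R.
Proof.
rewrite /frob2 (eq_bigr (fun=> 1)) => [|i _]; first by rewrite sumr_const card_ord.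
by rewrite big_ord1 mxE -exprM mulnC exprM sqrrN !expr1n.
Qed.

(** The rows of [M] divided by sqrt m are [p] orthonormal vectors: [sign_chaos_le] with a = 0. *)
Lemma stiefel_sign_sum p m (s : R) (M : 'M[R]_(p, m)) : (0 < m)%N ->
  M *m M^T = m%:R%:M ->
  \sum_(e : {ffun 'I_m -> bool}) expR (8^-1 * (frob2 (M *m signv R e) / m%:R - s)) <=
  2 ^+ m * (Num.sqrt 2 ^+ p * expR (- s / 8)).
Proof.
move=> m0 hM; have m0' : m%:R != 0 :> R by rewrite pnatr_eq0 -lt0n.
have sm0 : Num.sqrt m%:R != 0 :> R by rewrite sqrtr_eq0 -ltNge ltr0n.
pose b (i : 'I_p) : 'cV[R]_m := (Num.sqrt m%:R)^-1 *: (row i M)^T.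
have bb i j : mxdot (b i) (b j) = (i == j)%:R.
  have -> : mxdot (b i) (b j) = (M *m M^T) i j / m%:R.
    rewrite /b mxdotZl mxdotZr mulrA -invfM -expr2 sqr_sqrtr // mulrC; congr (_ / _).
    by rewrite mxE; apply: eq_bigr => l _; rewrite big_ord1 !mxE.
  by rewrite hM mxE; case: eqP => _; rewrite ?mulr1n ?mulr0n ?mul0r ?divff.
have fE e : frob2 (M *m signv R e) / m%:R =
    \sum_(v <- [seq b i | i <- enum 'I_p]) mxdot v (signv R e) ^+ 2.
  rewrite big_map big_enum /= /frob2 mulr_suml; apply: eq_bigr => i _.
  rewrite big_ord1 /b mxdotZl exprMn exprVn sqr_sqrtr // mulrC; congr (_ * _ ^+ 2).
  by rewrite mxE; apply: eq_bigr => l _; rewrite big_ord1 !mxE.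
have h1 v : v \in [seq b i | i <- enum 'I_p] -> frob2 v = 1.
  by move=> /mapP[i _ ->]; rewrite frob2E bb eqxx.
have h2 : pairwise (fun u v => mxdot u v == 0) [seq b i | i <- enum 'I_p].
  rewrite pairwise_map; have : uniq (enum 'I_p) := enum_uniq _.
  rewrite uniq_pairwise; apply: sub_pairwise => i j /= ij.
  by rewrite bb (negbTE ij).
have := sign_chaos_le 0 h1 h2.
rewrite size_map size_enum_ord => h3.
have -> : \sum_(e : {ffun 'I_m -> bool}) expR (8^-1 * (frob2 (M *m signv R e) / m%:R - s)) =
    expR (- s / 8) * \sum_(e : {ffun 'I_m -> bool}) expR (mxdot 0 (signv R e) +
      8^-1 * \sum_(v <- [seq b i | i <- enum 'I_p]) mxdot v (signv R e) ^+ 2).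
  rewrite mulr_sumr; apply: eq_bigr => e _; rewrite -expRD mxdotC mxdot0r -fE.
  by congr expR; field.
rewrite [leRHS]mulrA mulrC; apply: ler_wpM2r; first exact: expR_ge0.
apply: le_trans h3 _.
rewrite big1 => [|v _]; last by rewrite mxdotC mxdot0r expr0n.
by rewrite frob2E mxdot0r addr0 expR0 mulr1.
Qed.

(** By invariance the event keeps its probability when [u] is turned into any sign vector. Summing
    Markov bounds over all sign vectors and exchanging sum and integral leaves, for each value of W,
    the sum bounded by [stiefel_sign_sum]. *)
Theorem stiefel_tail d (T : measurableType d) (P : probability T R) p m
    (W : T -> 'M[R]_(p, m)) (u : 'cV[R]_m) (s : R) :
  random_mx W -> {ae P, forall w, W w *m (W w)^T = (m%:R : R)%:M} ->
  (forall Q : 'M[R]_m, orthogmx Q -> same_distr P W (fun w => W w *m Q)) ->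
  (P (W @^-1` [set M | (s * frob2 u < frob2 (M *m u))%R]) <=
    (Num.sqrt 2 ^+ p * expR (- s / 8))%:E)%E.
Proof.
move=> mW aeW invW; set A := [set M | _].
(* A zero [u] cannot be rotated onto a sign vector, but the strict inequality makes its event
   empty. *)
have [u0|u0] := eqVneq u 0.
  have -> : W @^-1` A = set0.
    by apply/seteqP; split=> // w; rewrite /A /= u0 mulmx0 !frob2E !mxdot0r mulr0 ltxx.
  by rewrite measure0 lee_fin mulr_ge0 ?expR_ge0 // exprn_ge0 // sqrtr_ge0.
have m0 : (0 < m)%N.
  by case: m u u0 {A aeW invW mW} W => // u; rewrite flatmx0 eqxx.
have m0' : 0 < m%:R :> R by rewrite ltr0n.
have nu0 : 0 < frob2 u by rewrite lt_def frob2_eq0 u0 frob2_ge0.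
pose X (e : {ffun 'I_m -> bool}) w := frob2 (W w *m signv R e) / m%:R.
have mX e : measurable_fun setT (X e).
  by apply: measurable_funM => //; exact: random_mx_frob2.
pose f e w := expR (8^-1 * (X e w - s)).
have mf e : measurable_fun setT (f e).
  apply: measurableT_comp => //; apply: measurable_funM => //.
  exact: measurable_funB.
have PA e : P (W @^-1` A) = P [set w | s < X e w].
  pose c := Num.sqrt (m%:R / frob2 u).
  have c0 : 0 < c ^+ 2 by rewrite sqr_sqrtr ?divr_gt0 // ltW // divr_gt0.
  have cE : c ^+ 2 = m%:R / frob2 u by rewrite sqr_sqrtr // ltW // divr_gt0.
  have [Q [QO Qu]] : exists Q, orthogmx Q /\ Q *m (c *: u) = signv R e.
    by apply: orthog_transitive; rewrite frob2Z frob2_signv cE divfK // gt_eqF.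
  rewrite (invW Q QO A); last exact: mx_events_frob2_gt.
  have XE w : (s * frob2 u < frob2 (W w *m Q *m u)) = (s < X e w).
    rewrite /X -Qu -scalemxAr -scalemxAr mulmxA frob2Z cE.
    have -> : m%:R / frob2 u * frob2 (W w *m Q *m u) / m%:R =
        frob2 (W w *m Q *m u) / frob2 u by field; rewrite !gt_eqF.
    by rewrite ltr_pdivlMr.
  by congr (P _); apply/seteqP; split=> w; rewrite /A /= XE.
have PAf e : (P (W @^-1` A) <= \int[P]_w (f e w)%:E)%E.
  have mS : measurable [set w | s < X e w].
    have := mX e measurableT _ (measurable_itv `]s, +oo[); rewrite setTI.
    by congr measurable; apply/seteqP; split=> w /=; rewrite in_itv /= andbT.
  rewrite (PA e) -(setIT [set w | _]) -integral_indic //.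
  apply: ge0_le_integral => //.
  - by apply/measurable_EFinP; exact: measurable_indic.
  - by apply/measurable_EFinP; exact: mf.
  (* On the event the exponent is nonnegative, so the exponential is at least 1. *)
  move=> w _; rewrite lee_fin indicE; case: (boolP (w \in _)) => [|_]; last exact: expR_ge0.
  rewrite inE /= => sX; apply: le_trans (expR_ge1Dx _).
  by rewrite lerDl mulr_ge0 // subr_ge0 ltW.
have sumE : ((2 ^+ m)%:E * P (W @^-1` A) <=
    \int[P]_w (\sum_(e : {ffun 'I_m -> bool}) (f e w)%:E))%E.
  rewrite ge0_integral_sum //; last 2 first.
  - by move=> e; apply/measurable_EFinP; exact: mf.
  - by move=> e w _; rewrite lee_fin expR_ge0.
  have -> : ((2 ^+ m)%:E * P (W @^-1` A) =
      \sum_(e : {ffun 'I_m -> bool}) P (W @^-1` A))%E.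
    have mWA : measurable (W @^-1` A).
      have := random_mx_frob2 u mW measurableT (measurable_itv `]s * frob2 u, +oo[).
      rewrite setTI; congr measurable; apply/seteqP.
      by split=> w; rewrite /A /= in_itv /= andbT.
    rewrite -(fineK (fin_num_measure P _ mWA)) sumEFin -EFinM; congr EFin.
    by rewrite sumr_const card_ffun card_bool card_ord -[RHS]mulr_natl natrX.
  exact: lee_sum.
have int_le : (\int[P]_w (\sum_(e : {ffun 'I_m -> bool}) (f e w)%:E) <=
    (2 ^+ m * (Num.sqrt 2 ^+ p * expR (- s / 8)))%:E)%E.
  set K := 2 ^+ m * _.
  have K0 : 0 <= K by rewrite !mulr_ge0 ?expR_ge0 ?exprn_ge0 ?sqrtr_ge0.
  apply: (@le_trans _ _ (\int[P]_w (cst K%:E w))%E); last first.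
    by rewrite integral_cst // [X in (_ * X)%E]probability_setT mule1.
  apply: ae_ge0_le_integral => //.
  - by move=> w _; apply: sume_ge0 => e _; rewrite lee_fin expR_ge0.
  - by apply: emeasurable_sum => e; apply/measurable_EFinP; exact: mf.
  apply: filterS aeW => w hw _; rewrite sumEFin lee_fin.
  exact: stiefel_sign_sum.
have := le_trans sumE int_le.
by rewrite (EFinM (2 ^+ m)) lee_pmul2l.
Qed.
End StiefelTail.

(** * Random initialisation *)

Section Cells.
Variable R : realType.

(** Thresholds spaced by [h] from -M on: two points more than [h] apart are separated by the first
    threshold above the smaller one. *)
Lemma threshold_grid (M h : R) : 0 < h -> exists (K : nat) (t : 'I_K -> R),
  forall x x', `|x| <= M -> `|x'| <= M ->
    (forall l, (t l < x) = (t l < x')) -> `|x - x'| <= h.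
Proof.
move=> h0; pose K := (Num.truncn (2 * M / h)).+1.
exists K, (fun l : 'I_K => - M + l%:R * h) => x x'.
wlog xx' : x x' / x <= x' => [H|].
  case/orP: (le_total x x'); first exact: H.
  by move/H => H' hx hx' hl; rewrite distrC; apply: H' => // l; rewrite hl.
move=> hx hx' hl; rewrite distrC ger0_norm ?subr_ge0 // leNgt; apply/negP => hh.
have [xM Mx] : - M <= x /\ x' <= M.
  by move: hx hx'; rewrite !ler_norml => /andP[? _] /andP[_ ?].
have xM0 : 0 <= (x + M) / h by rewrite divr_ge0 ?(ltW h0) //; lra.
have /andP[n1 n2] := truncn_itv xM0; set n := Num.truncn _ in n1 n2.
rewrite ler_pdivlMr // in n1; rewrite ltr_pdivrMr // in n2.
have n3 : n.+1%:R * h < 2 * M by rewrite -natr1; lra.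
have nK : (n.+1 < K)%N.
  rewrite -(ltr_nat R); apply: (@lt_trans _ _ (2 * M / h)).
    by rewrite ltr_pdivlMr.
  exact: truncnS_gt.
have := hl (Ordinal nK); rewrite /=.
have -> : - M + n.+1%:R * h < x' by rewrite -natr1; lra.
by apply/negP; rewrite -leNgt; lra.
Qed.

Lemma frobn_entries_le p q (A : 'M[R]_(p, q)) h : 0 <= h ->
  (forall i j, `|A i j| <= h) -> frobn A <= (p * q)%:R * h.
Proof.
move=> h0 hA; rewrite -ler_sqr ?nnegrE ?frobn_ge0 ?mulr_ge0 // sqr_frobn.
apply: (@le_trans _ _ (\sum_(i < p) \sum_(j < q) h ^+ 2)).
  apply: ler_sum => i _; apply: ler_sum => j _.
  by rewrite -(real_normK (num_real (A i j))) ler_sqr ?nnegrE.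
under eq_bigr do rewrite sumr_const card_ord.
rewrite sumr_const card_ord.
have -> : h ^+ 2 *+ q *+ p = (p * q)%:R * h ^+ 2 by rewrite -mulrnA mulnC mulr_natl.
rewrite exprMn; apply: ler_wpM2r; first exact: sqr_ge0.
by rewrite -natrX ler_nat; case: (p * q)%N => // n; rewrite leq_pmulr.
Qed.

Lemma entry_le_frobn p q (A : 'M[R]_(p, q)) i j : `|A i j| <= frobn A.
Proof.
rewrite -ler_sqr ?nnegrE ?frobn_ge0 // sqr_frobn (real_normK (num_real _)).
rewrite /frob2 (bigD1 i) //= (bigD1 j) //= -addrA lerDl addr_ge0 //.
  by apply: sumr_ge0 => l _; rewrite sqr_ge0.
by apply: sumr_ge0 => l _; apply: sumr_ge0 => l' _; rewrite sqr_ge0.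
Qed.

(** Names the grid box of a matrix by an element of a finite type, so that the boxes form a finite
    partition into events. *)
Definition code p q K (t : 'I_K -> R) (M : 'M[R]_(p, q)) :
    {ffun 'I_p * 'I_q * 'I_K -> bool} :=
  [ffun x => t x.2 < M x.1.1 x.1.2].

Lemma mx_events_code p q K (t : 'I_K -> R) z :
  @mx_events R p q [set M | code t M = z].
Proof.
apply: mx_events_measurable.
pose S (x : 'I_p * 'I_q * 'I_K) := [set M : 'M[R]_(p, q) | (t x.2 < M x.1.1 x.1.2) = z x].
have -> : [set M | code t M = z] = \big[setI/setT]_x S x.
  rewrite -bigcap_seq; apply/seteqP; split=> M /=.
    by move=> cz x _; rewrite /S /= -cz ffunE.
  by move=> h; apply/ffunP => x; rewrite ffunE; apply: h; rewrite /= mem_index_enum.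
apply: bigsetI_measurable => x _.
have mS : measurable ((fun M : g_sigma_algebraType
    [set A : set 'M[R]_(p, q) | exists i j (B : set R),
       measurable B /\ A = (fun M : 'M[R]_(p, q) => M i j) @^-1` B] =>
    M x.1.1 x.1.2) @^-1` `]t x.2, +oo[).
  rewrite -[X in measurable X]setTI.
  exact: (@random_mx_id R p q x.1.1 x.1.2 measurableT _ (measurable_itv _)).
case zx: (z x); last (move/measurableC: mS => mS);
  move: mS; congr measurable; apply/seteqP; split=> M; rewrite /S /= in_itv /= andbT zx.
- by [].
- by [].
- by move/negP/negbTE.
- by move=> ->.
Qed.

Lemma measure_bigU_le d (T : measurableType d) (P : probability T R) (I : eqType)
    (r : seq I) (F : I -> set T) : (forall i, measurable (F i)) ->
  (P (\big[setU/set0]_(i <- r) F i) <= \sum_(i <- r) P (F i))%E.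
Proof.
move=> mF; elim: r => [|i r IH]; first by rewrite !big_nil measure0.
rewrite !big_cons; apply: le_trans (measureU2 _ _ _) _ => //.
  exact: bigsetU_measurable.
exact: leeD2l.
Qed.

(** At every point exactly one of the indicators equals 1; integrate their sum. *)
Lemma sum_fibers d (T : measurableType d) (P : probability T R) (I : finType)
    (c : T -> I) : (forall i, measurable [set w | c w = i]) ->
  (\sum_i P [set w | c w = i] = 1)%E.
Proof.
move=> mc.
have -> : (\sum_i P [set w | c w = i] =
    \sum_i \int[P]_w (\1_[set w | c w = i] w)%:E)%E.
  by apply: eq_bigr => i _; rewrite integral_indic // setIT.
rewrite -ge0_integral_sum //.
- transitivity (\int[P]_w (cst 1%E w))%E; last first.
    by rewrite integral_cst // [X in (_ * X)%E]probability_setT mule1.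
  apply: eq_integral => w _; rewrite (bigD1 (c w)) //= indicE mem_set // big1 ?adde0 //.
  by move=> i ic; rewrite indicE memNset //= => ci; rewrite ci eqxx in ic.
- by move=> i; apply/measurable_EFinP; exact: measurable_indic.
Qed.
End Cells.

Section RandomInit.
Variable R : realType.

Lemma rv_events_preimage d (T : measurableType d) p q (W : T -> 'M[R]_(p, q)) A :
  @mx_events R p q A -> rv_events W (W @^-1` A).
Proof. by move=> mA; exists A. Qed.

Lemma rv_events_measurable d (T : measurableType d) p q (W : T -> 'M[R]_(p, q)) A :
  random_mx W -> rv_events W A -> measurable A.
Proof.
move=> mW [B mB <-].
pose G := [set A : set 'M[R]_(p, q) | exists i j (B : set R),
   measurable B /\ A = (fun M : 'M[R]_(p, q) => M i j) @^-1` B].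
have mW' : measurable_fun setT (W : T -> g_sigma_algebraType G).
  apply: (@measurability _ _ T (g_sigma_algebraType G) setT W G erefl) => _ [_ [i [j [C [mC ->]]]] <-].
  exact: (mW i j measurableT C mC).
by rewrite -[X in measurable X]setTI; exact: mW'.
Qed.

Lemma rv_events_setT d (T : measurableType d) p q (W : T -> 'M[R]_(p, q)) :
  rv_events W setT.
Proof.
exists setT; last by rewrite preimage_setT.
exact: (@measurableT _ (g_sigma_algebraType _)).
Qed.

Section Layers.
Variables (m dx k : nat).
Implicit Types (A : 'M[R]_(m, dx)) (V : 'I_k -> 'M[R]_m).

Definition isolayers A V : Prop :=
  A^T *m A = m%:R%:M /\ forall j, (V j)^T *m V j = m%:R%:M.

Let q : R := Num.sqrt m%:R.
Let q0 : 0 <= q. Proof. exact: sqrtr_ge0. Qed.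
Let q2 : q ^+ 2 = m%:R. Proof. by rewrite sqr_sqrtr. Qed.

Lemma isolayers_isom A V : isolayers A V ->
  (pre (lay V) A k)^T *m pre (lay V) A k = ((q ^+ k.+1) ^+ 2)%:M.
Proof.
case=> hA hV; apply: pre_isom; rewrite ?q2 // => j jk.
by rewrite (layE _ jk) hV.
Qed.

Definition layer_code K (t : 'I_K -> R) A V :=
  (code t A, [ffun j => code t (V j)]).

(** The products have scale [q^(k+1)], and an error [q^k] reaches at most that scale after
    multiplication by W_L. Passing to another point of the same box thus costs only an additive 1
    next to sqrt s. *)
Lemma layer_code_close : exists (K : nat) (t : 'I_K -> R), forall A A' V V',
  isolayers A V -> isolayers A' V' -> layer_code t A V = layer_code t A' V' ->
  opb (pre (lay V) A k - pre (lay V') A' k) (q ^+ k).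
Proof.
case: (posnP m) => [m0|m0].
  exists 0%N, (fun=> 0) => A A' V V' _ _ _ s Z.
  have -> : (pre (lay V) A k - pre (lay V') A' k) *m Z = 0.
    by apply/matrixP => i; have := ltn_ord i; rewrite {2}m0.
  by rewrite frobn0 mulr_ge0 ?frobn_ge0 ?exprn_ge0.
have qp : 0 < q by rewrite sqrtr_gt0 ltr0n.
(* Chosen so that 1 - (k+1) y = q / (q + 1), hence (1 + y)^(k+1) <= (q + 1) / q. *)
pose y : R := (k.+1%:R * (q + 1))^-1.
have y0 : 0 < y by rewrite invr_gt0 mulr_gt0 // ltr_wpDl.
have grow : q * ((1 + y) ^+ k.+1 - 1) <= 1.
  have h := expr_1D_le k.+1 (ltW y0).
  have e : 1 - k.+1%:R * y = q / (q + 1).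
    rewrite /y invfM mulrA divff ?pnatr_eq0 // mul1r.
    by field; rewrite gt_eqF // ltr_wpDl.
  move: h; rewrite e mulrA ler_pdivrMr ?ltr_wpDl // mul1r; lra.
pose N : R := (m * dx + m * m).+1%:R.
have N0 : 0 < N by rewrite ltr0n.
pose h := q * y / N; have h0 : 0 < h by rewrite divr_gt0 // mulr_gt0.
(* Bounds all entries, since a layer with [c] columns has Frobenius norm [q] times that of the
   identity of size [c]. *)
pose M := q * (frobn (1%:M : 'M[R]_dx) + frobn (1%:M : 'M[R]_m)).
have [K [t tP]] := threshold_grid M h0.
have isoM c (B : 'M[R]_(m, c)) : B^T *m B = m%:R%:M -> frobn B = q * frobn (1%:M : 'M[R]_c).
  move=> hB; apply/eqP; rewrite -(eqrXn2 (n := 2)) ?mulr_ge0 ?frobn_ge0 //.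
  by rewrite exprMn !sqr_frobn -[B in frob2 B]mulmx1 (frob2_scaled_isom _ hB) q2.
have close c (B B' : 'M[R]_(m, c)) : (m * c <= m * dx + m * m)%N ->
    q * frobn (1%:M : 'M[R]_c) <= M ->
    B^T *m B = m%:R%:M -> B'^T *m B' = m%:R%:M -> code t B = code t B' ->
    frobn (B - B') <= q * y.
  move=> cN cM hB hB' BB'.
  apply: le_trans (frobn_entries_le (ltW h0) _) _ => [i j|].
    rewrite !mxE; apply: tP.
    - by apply: le_trans (entry_le_frobn _ _ _) _; rewrite isoM.
    - by apply: le_trans (entry_le_frobn _ _ _) _; rewrite isoM.
    - by move=> l; have /ffunP/(_ (i, j, l)) := BB'; rewrite !ffunE.
  apply: (@le_trans _ _ (N * h)); last by rewrite /h mulrC divfK ?gt_eqF.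
  by rewrite ler_wpM2r ?(ltW h0) // ler_nat ltnW.
have M1 : q * frobn (1%:M : 'M[R]_dx) <= M.
  by rewrite ler_wpM2l // lerDl frobn_ge0.
have M2 : q * frobn (1%:M : 'M[R]_m) <= M.
  by rewrite ler_wpM2l // lerDr frobn_ge0.
exists K, t => A A' V V' [hA hV] [hA' hV'] [cA cV].
apply: opb_le (pre_dev q0 (ltW y0) _ _ _) _.
- by apply: opb_isom; rewrite // q2.
- apply: opb_le (@opb_frobn _ _ _ _) _.
  by apply: close => //; rewrite leq_addr.
- move=> j jk; rewrite !(layE _ jk); split; first by apply: opb_isom; rewrite // q2.
  apply: opb_le (@opb_frobn _ _ _ _) _.
  apply: close => //; first by rewrite leq_addl.
  by have /ffunP/(_ (Ordinal jk)) := cV; rewrite !ffunE.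
rewrite exprSr -mulrA -[leRHS]mulr1; apply: ler_wpM2l => //.
by rewrite exprn_ge0.
Qed.
End Layers.

Theorem random_init_event d (T : measurableType d) (P : probability T R)
    dx dy m k r (W1 : T -> 'M[R]_(m, dx)) (Wm : 'I_k -> T -> 'M[R]_m)
    (WL : T -> 'M[R]_(dy, m)) (v : 'I_r -> 'cV[R]_dx) (s delta : R) :
  random_mx W1 -> (forall j, random_mx (Wm j)) -> random_mx WL ->
  (forall (A1 AL : set T) (Am : 'I_k -> set T),
     rv_events W1 A1 -> rv_events WL AL -> (forall j, rv_events (Wm j) (Am j)) ->
     P (A1 `&` AL `&` \bigcap_j Am j) = (P A1 * P AL * \prod_j P (Am j))%E) ->
  {ae P, forall w, (W1 w)^T *m W1 w = (m%:R : R)%:M} ->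
  (forall j, {ae P, forall w, (Wm j w)^T *m Wm j w = (m%:R : R)%:M /\
                              Wm j w *m (Wm j w)^T = (m%:R : R)%:M}) ->
  {ae P, forall w, WL w *m (WL w)^T = (m%:R : R)%:M} ->
  (forall Q : 'M[R]_m, orthogmx Q -> same_distr P WL (fun w => WL w *m Q)) ->
  0 <= s -> r%:R * (Num.sqrt 2 ^+ dy * expR (- s / 8)) <= delta ->
  exists E : set T, measurable E /\ ((1 - delta)%:E <= P E)%E /\
    forall w, E w ->
    [/\ (W1 w)^T *m W1 w = m%:R%:M,
        forall j, (Wm j w)^T *m Wm j w = m%:R%:M /\ Wm j w *m (Wm j w)^T = m%:R%:M,
        WL w *m (WL w)^T = m%:R%:M &
        forall i, frob2 (netprod (NetP (W1 w) (fun j => Wm j w) (WL w)) *m v i) <=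
          (2 * s + 2) * m%:R ^+ k.+1 * frob2 (v i)].
Proof.
move=> mW1 mWm mWL indep ae1 aem aeL invL s0 hdelta.
set kap := Num.sqrt 2 ^+ dy * _ in hdelta.
have kap0 : 0 <= kap by rewrite mulr_ge0 ?expR_ge0 // exprn_ge0 // sqrtr_ge0.
pose good w := [/\ (W1 w)^T *m W1 w = m%:R%:M,
  forall j, (Wm j w)^T *m Wm j w = m%:R%:M /\ Wm j w *m (Wm j w)^T = m%:R%:M &
  WL w *m (WL w)^T = m%:R%:M].
have [N [mN PN0 goodN]] : P.-negligible (~` [set w | good w]).
  have aem' : {ae P, forall w, forall j, (Wm j w)^T *m Wm j w = m%:R%:M /\
      Wm j w *m (Wm j w)^T = m%:R%:M} by apply: filter_forall.
  have : {ae P, forall w, good w}.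
    by apply: filterS3 ae1 aem' aeL => w h1 hm hL; split.
  by [].
pose Vm w j := Wm j w.
pose pp w := pre (lay (Vm w)) (W1 w) k.
have goodI w : good w -> isolayers (W1 w) (Vm w).
  by case=> h1 hm _; split=> // j; case: (hm j).
have [K [t tP]] := @layer_code_close m dx k.
pose c w := layer_code t (W1 w) (Vm w).
(* A deterministic product attached to the box [z], taken at some good point of it; boxes without
   good points receive 0. *)
pose U z : 'M[R]_(m, dx) := match pselect (exists w, good w /\ c w = z) with
  | left e => pp (proj1_sig (cid e)) | right _ => 0 end.
have UP w : good w -> exists w0, [/\ good w0, c w0 = c w & U (c w) = pp w0].
  move=> gw; rewrite /U; case: pselect => [e|]; last by case; exists w.
  by case: (cid e) => w0 [g0 c0] /=; exists w0.
pose Cz z := [set w | c w = z].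
pose AL i z := WL @^-1` [set M | s * frob2 (U z *m v i) < frob2 (M *m (U z *m v i))].
pose D (x : 'I_r * _) := Cz x.2 `&` AL x.1 x.2.
have CzE z : Cz z = (W1 @^-1` [set M | code t M = z.1]) `&` setT `&`
    \bigcap_j (Wm j @^-1` [set M | code t M = z.2 j]).
  rewrite setIT; apply/seteqP; split=> w /=.
    by move=> <-; split=> // j _ /=; rewrite ffunE.
  case=> h1 hm; rewrite /Cz /= /c /layer_code h1 [RHS]surjective_pairing; congr pair.
  by apply/ffunP => j; rewrite ffunE; apply: hm.
have ev1 z := rv_events_preimage W1 (mx_events_code t (z : {ffun 'I_m * 'I_dx * 'I_K -> bool})).
have evm j z := rv_events_preimage (Wm j) (mx_events_code t (z : {ffun 'I_m * 'I_m * 'I_K -> bool})).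
have evL i z : rv_events WL (AL i z).
  by apply: rv_events_preimage; exact: mx_events_frob2_gt.
have mCz z : measurable (Cz z).
  rewrite CzE setIT; apply: measurableI; first exact: rv_events_measurable (ev1 _).
  apply: fin_bigcap_measurable; first exact: finite_finset.
  by move=> j _; exact: rv_events_measurable (evm _ _).
have mD x : measurable (D x).
  by apply: measurableI => //; exact: rv_events_measurable (evL _ _).
(* Independence of W_L from the box gives the factorisation; [setT] fills the place of W_L when the
   product formula is applied to the box alone. *)
have PD x : (P (D x) <= P (Cz x.2) * kap%:E)%E.
  have PDE : P (D x) = (P (Cz x.2) * P (AL x.1 x.2))%E.
    have -> : D x = (W1 @^-1` [set M | code t M = x.2.1]) `&` AL x.1 x.2 `&`
        \bigcap_j (Wm j @^-1` [set M | code t M = x.2.2 j]).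
      by rewrite /D CzE setIT setIAC.
    rewrite CzE !indep //; first by rewrite [P setT]probability_setT mule1 muleAC.
    exact: rv_events_setT.
  by rewrite PDE; apply: lee_wpmul2l => //; exact: stiefel_tail.
pose B := \big[setU/set0]_(x : 'I_r * _) D x.
have mB : measurable B by apply: bigsetU_measurable.
(* For each vector the box probabilities add up to 1, so the union bound costs only the factor
   [r]. *)
have PB : (P B <= delta%:E)%E.
  apply: le_trans (measure_bigU_le _ _ mD) _.
  apply: (@le_trans _ _ (\sum_(i < r) \sum_z P (Cz z) * kap%:E)%E).
    by rewrite pair_bigA /=; apply: lee_sum => x _; exact: PD.
  have -> : (\sum_(i < r) \sum_z P (Cz z) * kap%:E = \sum_(i < r) kap%:E)%E.
    apply: eq_bigr => i _; rewrite -ge0_sume_distrl //.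
    by rewrite (sum_fibers P mCz) mul1e.
  by rewrite sumEFin lee_fin sumr_const card_ord -mulr_natl.
exists (~` (N `|` B)); split; first by apply: measurableC; exact: measurableU.
split.
  rewrite probability_setC; last exact: measurableU.
  have PNB : (P (N `|` B) <= delta%:E)%E.
    apply: le_trans (measureU2 _ mN mB) _.
    by rewrite [X in (X + _ <= _)%E](PN0 : P N = 0%E) add0e.
  by rewrite EFinB leeB.
move=> w /= nNB.
have gw : good w.
  by apply: contrapT => ng; apply: nNB; left; apply: goodN.
have [g1 gm gL] := gw; split=> // i.
have [w0 [g0 c0 UE]] := UP w gw.
have nD : ~ (s * frob2 (U (c w) *m v i) < frob2 (WL w *m (U (c w) *m v i))).
  move=> h; apply: nNB; right; rewrite /B (bigD1 (i, c w)) //=; left.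
  by split.
move/negP: nD; rewrite -leNgt UE => nD.
rewrite netprod_pre /npre /= -/(pp w).
pose q : R := Num.sqrt m%:R.
have q0 : 0 <= q := sqrtr_ge0 _.
have q2 : q ^+ 2 = m%:R by rewrite sqr_sqrtr.
have cl : opb (pp w - pp w0) (q ^+ k).
  by apply: tP; [exact: goodI | exact: goodI | rewrite -[LHS]/(c w) -[RHS]/(c w0)].
have WLq : opb (WL w) q.
  by rewrite -(trmxK (WL w)); apply: opb_tr => //; apply: opb_isom; rewrite // trmxK q2.
have U2 : frob2 (pp w0 *m v i) = (q ^+ k.+1) ^+ 2 * frob2 (v i).
  by rewrite (frob2_scaled_isom _ (isolayers_isom (goodI _ g0))).
have qk0 : 0 <= q ^+ k.+1 by rewrite exprn_ge0.
have h1 : frobn (WL w *m (pp w0 *m v i)) <= Num.sqrt s * (q ^+ k.+1 * frobn (v i)).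
  rewrite -ler_sqr ?nnegrE ?frobn_ge0 ?mulr_ge0 ?sqrtr_ge0 ?frobn_ge0 //.
  by rewrite sqr_frobn !exprMn sqr_sqrtr // sqr_frobn -U2.
have h2 : frobn (WL w *m ((pp w - pp w0) *m v i)) <= q ^+ k.+1 * frobn (v i).
  apply: le_trans (WLq _ _) _; rewrite exprS -mulrA ler_wpM2l //.
have h3 : frobn (WL w *m pp w *m v i) <= (Num.sqrt s + 1) * (q ^+ k.+1 * frobn (v i)).
  have -> : WL w *m pp w *m v i =
      WL w *m (pp w0 *m v i) + WL w *m ((pp w - pp w0) *m v i).
    by rewrite -mulmxDr -mulmxDl addrC subrK mulmxA.
  by apply: le_trans (frobnD _ _) _; rewrite mulrDl mul1r lerD.
have -> : (2 * s + 2) * m%:R ^+ k.+1 * frob2 (v i) =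
    (2 * s + 2) * (q ^+ k.+1 * frobn (v i)) ^+ 2.
  have -> : m%:R ^+ k.+1 = (q ^+ k.+1) ^+ 2 :> R by rewrite -q2 -!exprM mulnC.
  by rewrite -sqr_frobn; ring.
rewrite -sqr_frobn; apply: (@le_trans _ _ (((Num.sqrt s + 1) * (q ^+ k.+1 * frobn (v i))) ^+ 2)).
  by rewrite ler_sqr ?nnegrE ?frobn_ge0 // !mulr_ge0 ?frobn_ge0 ?addr_ge0 ?sqrtr_ge0.
rewrite exprMn; apply: ler_wpM2r; first exact: sqr_ge0.
(* (sqrt s + 1)^2 <= 2s + 2 amounts to (sqrt s - 1)^2 >= 0. *)
by have := sqr_ge0 (Num.sqrt s - 1); rewrite -(sqr_sqrtr s0) sqrtr_sqr ger0_norm ?sqrtr_ge0 //; nra.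
Qed.
End RandomInit.

(** * Reduction to r vectors and assembly of the constants *)

Lemma frob2_rank_decomp (R : realType) p n (X : 'M[R]_(p, n)) : X != 0 ->
  exists v : 'I_(\rank X) -> 'cV[R]_p,
  forall s (G : 'M[R]_(s, p)), frob2 (G *m X) = \sum_i frob2 (G *m v i).
Proof.
move=> X0; have [Q [d [QO XE rk _ _]]] := gram_spectrum X0.
(* In the eigenbasis of X^T X only r columns of X are nonzero; using these instead of the n original
   columns puts r into the logarithm. *)
rewrite -rk; exists (fun i => col (enum_val i) (X *m Q^T)) => s G.
have -> : frob2 (G *m X) = frob2 (G *m (X *m Q^T)).
  rewrite mulmxA -(frob2_tr (_ *m Q^T)) trmx_mul trmxK.
  by rewrite (frob2_scaled_isom _ (QO : _ = 1%:M)) mul1r frob2_tr.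
rewrite frob2_cols -(big_enum_val (fun j => frob2 (G *m col j (X *m Q^T)))) /=.
rewrite [RHS]big_mkcond; apply: eq_bigr => j _ /=.
have -> : col j (G *m (X *m Q^T)) = G *m col j (X *m Q^T).
  by rewrite colE -mulmxA -colE.
rewrite inE; case: eqP => //= dj; rewrite (gram_col_eq0 QO XE dj) mulmx0.
by apply/eqP; rewrite frob2_eq0.
Qed.

Lemma sqr_alpha (R : realType) k m dy : (0 < m)%N -> (0 < dy)%N ->
  alpha R k.+2 m dy ^+ 2 * m%:R ^+ k.+1 = dy%:R^-1.
Proof.
move=> m0 dy0; rewrite /alpha exprVn sqr_sqrtr // natrM natrX.
by rewrite invfM mulrAC mulVf ?mul1r // expf_neq0 // pnatr_eq0 -lt0n.
Qed.

(** A consequence of 2 <= e; it absorbs the factor sqrt 2 per output dimension. *)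
Lemma sqrt2_pow_expR_le (R : realType) (d : nat) : Num.sqrt 2 ^+ d * expR (- d%:R / 2) <= 1 :> R.
Proof.
have -> : - d%:R / 2 = d%:R * (- 2^-1) :> R by field.
rewrite expRM_natl -exprMn exprn_ile1 ?mulr_ge0 ?sqrtr_ge0 ?expR_ge0 //.
rewrite expRN ler_pdivrMr ?expR_gt0 // mul1r.
rewrite -ler_sqr ?nnegrE ?sqrtr_ge0 ?expR_ge0 // sqr_sqrtr // -expRM_natl.
by rewrite divff //; apply: le_trans (expR_ge1Dx 1).
Qed.

Theorem theorem4p1 (R : realType) :
  exists C C' : R, 0 < C /\ 0 < C' /\
  forall (dx dy n : nat) (X : 'M[R]_(dx, n)) (Y : 'M[R]_(dy, n)) (L m : nat),
  (2 <= L)%N -> (dx <= m)%N -> (dy <= m)%N ->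
  forall (d : measure_display) (Omega : measurableType d) (P : probability Omega R)
    (W1 : Omega -> 'M[R]_(m, dx)) (Wm : 'I_(L - 2) -> Omega -> 'M[R]_m)
    (WL : Omega -> 'M[R]_(dy, m)),
  (* W_1(0), ..., W_L(0) are random matrices *)
  random_mx W1 -> (forall j, random_mx (Wm j)) -> random_mx WL ->
  (* ... which are mutually independent *)
  (forall (A1 AL : set Omega) (Am : 'I_(L - 2) -> set Omega),
     rv_events W1 A1 -> rv_events WL AL -> (forall j, rv_events (Wm j) (Am j)) ->
     P (A1 `&` AL `&` \bigcap_j Am j) = (P A1 * P AL * \prod_j P (Am j))%E) ->
  (* W_1(0) is uniform on { W : W^T W = m I_dx } *)
  {ae P, forall w, (W1 w)^T *m W1 w = (m%:R : R)%:M} ->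
  (forall Q : 'M[R]_m, orthogmx Q -> same_distr P W1 (fun w => Q *m W1 w)) ->
  (* W_i(0), 2 <= i <= L-1, is uniform on { W : W^T W = W W^T = m I_m } *)
  (forall j, {ae P, forall w, (Wm j w)^T *m Wm j w = (m%:R : R)%:M /\
                              Wm j w *m (Wm j w)^T = (m%:R : R)%:M}) ->
  (forall j (Q : 'M[R]_m), orthogmx Q -> same_distr P (Wm j) (fun w => Q *m Wm j w)) ->
  (* W_L(0) is uniform on { W : W W^T = m I_dy } *)
  {ae P, forall w, WL w *m (WL w)^T = (m%:R : R)%:M} ->
  (forall Q : 'M[R]_m, orthogmx Q -> same_distr P WL (fun w => WL w *m Q)) ->
  forall (Wstar : 'M[R]_(dy, dx)),
  (forall W : 'M[R]_(dy, dx), frobn (Wstar *m X - Y) <= frobn (W *m X - Y)) ->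
  forall delta eta : R,
  let ellstar := 2^-1 * frob2 (Wstar *m X - Y) in
  let r := \rank X in
  let kappa := lam_max (X^T *m X) / lam r (X^T *m X) in
  let rtilde := frob2 X / specn X ^+ 2 in
  0 < delta < 1 ->
  C * rtilde * kappa ^+ 2 *
     (dy%:R * (1 + specn Wstar ^+ 2) + ln (r%:R / delta)) <= m%:R ->
  0 < eta -> eta <= dy%:R / (2 * L%:R * specn X ^+ 2) ->
  let ell (w : Omega) (t : nat) : R :=
    nloss X Y (gd_iter X Y eta (NetP (W1 w) (fun j => Wm j w) (WL w)) t) in
  exists E : set Omega, measurable E /\ ((1 - delta)%:E <= P E)%E /\
    forall w, E w ->
      ell w 0%N - ellstar <=
        C' * (1 + ln (r%:R / delta) / dy%:R + specn Wstar ^+ 2) * frob2 X /\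
      forall t : nat,
        ell w t - ellstar <=
          (1 - 2^-1 * eta * L%:R * lam r (X^T *m X) / dy%:R) ^+ t *
          (ell w 0%N - ellstar).
Proof.
(* 32 comes from the bound [e0le] on |E(0)|^2, 140^2 from squaring the hypothesis of
   [gd_linear_rate], and 16 is half of 32. *)
exists (32 * 140 ^+ 2), 16; split; [by rewrite mulr_gt0 ?exprn_gt0 | split=> //].
move=> dx dy n X Y L m L2 dxm dym d Omega P W1 Wm WL mW1 mWm mWL indep ae1 _ aem _.
move=> aeL invL Ws WsP delta eta ellstar r kappa rtilde /andP[delta0 delta1].
have Lk : L%:R = (L - 2).+2%:R :> R by congr (_%:R); lia.
rewrite Lk; set k := (L - 2)%N in Wm mWm indep aem *.
move=> mC eta0 eta_le ell.
have dy0 : (0 < dy)%N.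
  (* The cases dy = 0 and |X| = 0 are excluded by the step size: both make its upper bound 0,
     division by 0 giving 0. *)
  rewrite lt0n; apply/eqP => dy0; move: eta_le; rewrite dy0 mul0r.
  by rewrite leNgt eta0.
have m0 : (0 < m)%N by exact: leq_trans dym.
set sg := specn X in rtilde mC eta_le.
have sg0 : 0 < sg.
  rewrite lt_def specn_ge0 andbT; apply/eqP => sg0; move: eta_le.
  by rewrite sg0 expr0n mulr0 invr0 mulr0 leNgt eta0.
have X0 : X != 0.
  apply/eqP => X0; have : sg <= 0; last by rewrite leNgt sg0.
  by apply: specn_le => // v; rewrite X0 mul0mx frobn0 mul0r.
have [_ [_ [_ _ _ la0 _]]] := gram_spectrum X0.
rewrite -/r in la0; set la := lam r _ in kappa mC la0 *.
have lmax := specn_sqr_le_lam_max X0; rewrite -/sg in lmax.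
have fX0 : 0 < frob2 X by rewrite lt_def frob2_eq0 X0 frob2_ge0.
have Xla (s : nat) (Z : 'M[R]_(s, dx)) : la * frob2 (Z *m X) <= frob2 (Z *m X *m X^T).
  exact: frob2_gram_ge.
have la_sg : la <= sg ^+ 2.
  rewrite -(ler_pM2r fX0); have := Xla _ 1%:M; rewrite !mul1mx => h.
  apply: le_trans h _; rewrite -!sqr_frobn -exprMn ler_sqr ?nnegrE ?mulr_ge0 ?frobn_ge0 ?(ltW sg0) //.
  rewrite -(frobn_tr X) -{1}(frobn_tr (X *m _)) trmx_mul trmxK.
  by apply: opb_specn.
have dyR : 0 < dy%:R :> R by rewrite ltr0n.
have eta_le' : eta * k.+2%:R * sg ^+ 2 <= dy%:R / 2.
  move: eta_le; rewrite ler_pdivlMr; last by rewrite !mulr_gt0 ?exprn_gt0.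
  by lra.
have r0 : (0 < r)%N by rewrite lt0n mxrank_eq0.
have rR : 1 <= r%:R :> R by rewrite ler1n.
have rd1 : 1 < r%:R / delta.
  by rewrite ltr_pdivlMr // mul1r (lt_le_trans delta1).
set lg := ln _ in mC *.
have lg0 : 0 <= lg by rewrite ln_ge0 // ltW.
(* At rate 1/8, [8 * lg] supplies the factor delta / r and [4 * dy] offsets the powers of sqrt 2. *)
pose s := 8 * lg + 4 * dy%:R.
have s0 : 0 <= s by rewrite addr_ge0 // mulr_ge0 // ltW.
have hdelta : r%:R * (Num.sqrt 2 ^+ dy * expR (- s / 8)) <= delta.
  have -> : - s / 8 = - dy%:R / 2 + - lg by rewrite /s; field.
  rewrite expRD expRN lnK; last by rewrite posrE (lt_trans _ rd1).
  have -> : r%:R * (Num.sqrt 2 ^+ dy * (expR (- dy%:R / 2) * (r%:R / delta)^-1)) =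
      Num.sqrt 2 ^+ dy * expR (- dy%:R / 2) * delta.
    have rn0 : r%:R != 0 :> R by rewrite gt_eqF // (lt_le_trans ltr01).
    have dn0 : delta != 0 by rewrite gt_eqF.
    by field; rewrite dn0 rn0.
  by rewrite ler_piMl ?(ltW delta0) // sqrt2_pow_expR_le.
have [v vP] := frob2_rank_decomp X0.
have [E [mE [PE EP]]] := random_init_event v mW1 mWm mWL indep ae1 aem aeL invL s0 hdelta.
exists E; split=> //; split=> // w /EP[g1 gm gL hv].
set p0 := NetP (W1 w) _ (WL w) in hv.
have nrm : (Ws *m X - Y) *m X^T = 0 by apply: lsq_normal.
set ws := specn Ws in mC *.
pose Kc := 1 + lg / dy%:R + ws ^+ 2.
have e0le : frob2 (gap X Ws p0) <= 32 * Kc * frob2 X.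
  have h1 : frob2 (alpha R k.+2 m dy *: netprod p0 *m X) <= (2 * s + 2) / dy%:R * frob2 X.
    rewrite -scalemxAl frob2Z vP -[X in _ * frob2 X]mul1mx (vP _ 1%:M) !mulr_sumr.
    apply: ler_sum => i _; rewrite mul1mx.
    apply: le_trans (ler_wpM2l (sqr_ge0 _) (hv i)) _.
    by rewrite -(sqr_alpha R k m0 dy0) le_eqVlt; apply/orP; left; apply/eqP; ring.
  have h2 : frob2 (Ws *m X) <= ws ^+ 2 * frob2 X.
    rewrite -!sqr_frobn -exprMn ler_sqr ?nnegrE ?mulr_ge0 ?frobn_ge0 ?specn_ge0 //.
    exact: opb_specn.
  have h3 : frob2 (gap X Ws p0) <=
      2 * frob2 (alpha R k.+2 m dy *: netprod p0 *m X) + 2 * frob2 (Ws *m X).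
    rewrite /gap mulmxBl frob2B.
    by have := frob2_ge0 (alpha R k.+2 m dy *: netprod p0 *m X + Ws *m X); rewrite frob2D; lra.
  (* 2s + 2 = 16 lg + 8 dy + 2, and dy >= 1 absorbs the 2. The doubling in [h3] then turns 16 into
     32. *)
  have h4 : (2 * s + 2) / dy%:R <= 16 * (1 + lg / dy%:R).
    rewrite ler_pdivrMr //.
    have -> : 16 * (1 + lg / dy%:R) * dy%:R = 16 * (dy%:R + lg).
      by field; rewrite gt_eqF.
    rewrite /s.
    by have : 1 <= dy%:R :> R by [rewrite ler1n]; lra.
  have h5 := ler_wpM2r (ltW fX0) h4.
  have h6 : 0 <= ws ^+ 2 * frob2 X by rewrite mulr_ge0 ?sqr_ge0 // ltW.
  by rewrite /Kc; lra.
split.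
  rewrite /ell /= (nloss_gap nrm); move: e0le; rewrite /Kc; lra.
move=> t; rewrite /ell /ellstar /=.
apply: (@gd_linear_rate R dx dy m k n X Y Ws nrm dy0 m0 sg la eta) => //.
- exact: ltW.
- exact: opb_specn.
- by move=> j; case: (gm j).
- by move=> j; case: (gm j).
rewrite -ler_sqr ?nnegrE ?mulr_ge0 ?sqrtr_ge0 ?frobn_ge0 ?(ltW sg0) ?(ltW la0) //.
rewrite !exprMn sqr_frobn !sqr_sqrtr //.
have la2 : 0 < la ^+ 2 by rewrite exprn_gt0.
have sg2 : 0 < sg ^+ 2 by rewrite exprn_gt0.
pose Z := dy%:R * (1 + ws ^+ 2) + lg.
have Z0 : 0 <= Z by rewrite addr_ge0 // mulr_ge0 ?addr_ge0 ?sqr_ge0 // ltW.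
(* The la^2 in the denominator of kappa^2 cancels, and lam_max^2 / sg^2 >= sg^2. *)
have m1 : 32 * 140 ^+ 2 * (frob2 X * Z) * sg ^+ 2 <= m%:R * la ^+ 2.
  have h1 := ler_wpM2r (ltW la2) mC; apply: le_trans h1.
  have -> : 32 * 140 ^+ 2 * rtilde * kappa ^+ 2 * Z * la ^+ 2 =
      32 * 140 ^+ 2 * (frob2 X * Z) / sg ^+ 2 * lam_max (X^T *m X) ^+ 2.
    by rewrite /rtilde /kappa; field; rewrite !gt_eqF.
  rewrite -[in leRHS]mulrA ler_wpM2l ?mulr_ge0 ?(ltW fX0) //.
  rewrite mulrC ler_pdivlMr // -expr2 ler_sqr ?nnegrE ?(ltW sg2) //.
  exact: le_trans (ltW sg2) lmax.
apply: le_trans m1.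
have h1 := ler_wpM2l (mulr_ge0 (ltW dyR) (ltW sg2)) e0le.
have -> : 32 * 140 ^+ 2 * (frob2 X * Z) * sg ^+ 2 = 140 ^+ 2 * (dy%:R * sg ^+ 2 * (32 * Kc * frob2 X)).
  by rewrite /Z /Kc; field; rewrite gt_eqF.
lra.
Qed.
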